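(* Let $\mathcal{L}=\sum_{|I|=\nu}c_I X_I$ be a generalized Rockland operator on $\mathbb{R}^n$ (in the sense defined in the context). Then $\mathcal{L}$ is hypoelliptic in $\mathbb{R}^n$, that is: for every open set $\Omega\subseteq\mathbb{R}^n$, every distribution $u\in\mathcal{D}'(\Omega)$ and every open $\Omega'\subseteq\Omega$, if $\mathcal{L}u\in C^\infty(\Omega')$ then $u\in C^\infty(\Omega')$.
   Context: **Assumption on the vector fields.** $X=\{X_1,\dots,X_m\}$ is a family of real smooth vector fields on $\mathbb{R}^n$, linearly independent in the (infinite-dimensional) real vector space of smooth vector fields on $\mathbb{R}^n$, satisfying Hörmander's condition at the origin (the vector fields in the Lie algebra $\mathrm{Lie}(X)$ generated by $X$, evaluated at $0$, span $\mathbb{R}^n$). $\mathbb{R}^n$ carries dilations $\delta_\lambda(x)=(\lambda^{\sigma_1}x_1,\dots,\lambda^{\sigma_n}x_n)$, $\lambda>0$, with integers $1=\sigma_1\le\sigma_2\le\dots\le\sigma_n$, and each $X_i$ is $\delta_\lambda$-homogeneous of positive integer degree $\nu_i$: $X_i(u\circ\delta_\lambda)=\lambda^{\nu_i}(X_iu)\circ\delta_\lambda$ for all $\lambda>0$, $u\in C^\infty(\mathbb{R}^n)$; moreover $1\le\nu_1\le\dots\le\nu_m$. Put $q=\sum_{i=1}^n\sigma_i$. It follows that $N:=\dim\mathrm{Lie}(X)$ is finite and $N\ge n$; put $p=N-n$. **Operators.** For a multi-index $I=(i_1,\dots,i_k)$ with $i_j\in\{1,\dots,m\}$, put $X_I=X_{i_1}\cdots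 X_{i_k}$ and $|I|=\nu_{i_1}+\dots+\nu_{i_k}$. $\mathcal{L}=\sum_{|I|=\nu}c_IX_I$, with $\nu$ a positive integer and given real constants $c_I$. **Homogeneous group.** A homogeneous group $\mathbb{G}=(\mathbb{R}^N,\star,D_\lambda)$ is a Lie group structure on $\mathbb{R}^N$ (with neutral element $0$) together with diagonal dilations $D_\lambda$ (positive exponents) that are group automorphisms; $\mathrm{Lie}(\mathbb{G})$ is the Lie algebra of its left-invariant vector fields; its homogeneous dimension is the sum of the exponents of $D_\lambda$. **Lifting.** Assume $p\ge1$ and write points of $\mathbb{R}^N=\mathbb{R}^n\times\mathbb{R}^p$ as $(x,\xi)$. By a lifting theorem of Biagi and Bonfiglioli there exist a homogeneous group $\mathbb{G}=(\mathbb{R}^N,\star,D_\lambda)$, of homogeneous dimension $Q>q$, with $D_\lambda(x,\xi)=(\delta_\lambda(x),E_\lambda(\xi))$, $E_\lambda(\xi)=(\lambda^{\tau_1}\xi_1,\dots,\lambda^{\tau_p}\xi_p)$ for integers $1\le\tau_1\le\dots\le\tau_p$, and vector fields $\widetilde X_1,\dots,\widetilde X_m\in\mathrm{Lie}(\mathbb{G})$ generating $\mathrm{Lie}(\mathbb{G})$ as a Lie algebra, such that $\widetilde X_j$ is $D_\lambda$-homogeneous of degree $\nu_j$ and $\widetilde X_j=X_j+R_j$, where $R_j$ is a non-vanishing smooth vector field operating only in the $\xi$ variables (with coefficients possibly depending on $(x,\xi)$). This group and these vector fields are fixed. The lifted operator is $\widetilde{\mathcal{L}}=\sum_{|I|=\nu}c_I\widetilde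 X_I$, with $\widetilde X_I=\widetilde X_{i_1}\cdots\widetilde X_{i_k}$. **Generalized Rockland operator.** $\mathcal{L}=\sum_{|I|=\nu}c_IX_I$ is a generalized Rockland operator if $X_1,\dots,X_m$ satisfy the assumption above, $p\ge1$, and the lifted operator $\widetilde{\mathcal{L}}$ is hypoelliptic on $\mathbb{R}^N$ (same definition of hypoellipticity, with $\mathbb{R}^N$ in place of $\mathbb{R}^n$). *)

(* Defs.v *)
From mathcomp Require Import all_boot all_order all_algebra.
From mathcomp Require Import all_classical all_reals all_analysis.

Set Implicit Arguments.
Unset Strict Implicit.
Unset Printing Implicit Defensive.

Import Order.TTheory GRing.Theory Num.Theory.
Import numFieldNormedType.Exports.

Local Open Scope classical_set_scope.
Local Open Scope ring_scope.

(** * Smooth functions, test functions *)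

Section smooth.
Context {R : realType} {n : nat}.
Implicit Types (f : 'rV[R]_n -> R) (s : seq 'I_n) (Omega : set 'rV[R]_n).

Definition pderiv (i : 'I_n) f : 'rV[R]_n -> R :=
  fun x => 'D_(delta_mx 0 i : 'rV[R]_n) f x.

Definition pderivs s f : 'rV[R]_n -> R := foldr pderiv f s.

(** Only meant for open [Omega]. *)
Definition smooth_on Omega f : Prop :=
  forall s x, Omega x ->
    {for x, continuous (pderivs s f)} /\
    (forall i, derivable (pderivs s f) x (delta_mx 0 i : 'rV[R]_n)).

Definition closed_support f : set 'rV[R]_n := closure [set x | f x != 0].

Definition test_function Omega : set ('rV[R]_n -> R) :=
  [set phi | [/\ smooth_on setT phi, compact (closed_support phi) &
                 closed_support phi `<=` Omega]].

Definition Ck_norm (k : nat) f : R :=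
  \sum_(j < k.+1) \sum_(s : j.-tuple 'I_n)
    sup (range (fun x => `|pderivs s f x|)).

End smooth.

Definition smooth_map {R : realType} {n k : nat} (F : 'rV[R]_n -> 'rV[R]_k) :
  Prop := forall j, smooth_on setT (fun x => F x 0 j).

(** The Lebesgue integral over R^n, as an iterated one-dimensional Lebesgue
    integral; it is only applied to continuous compactly supported functions. *)
Fixpoint Rn_integral {R : realType} (n : nat) : ('rV[R]_n -> R) -> R :=
  match n with
  | 0 => fun f => f 0
  | n'.+1 => fun f =>
      Rintegral (@lebesgue_measure R) setT
        (fun t => Rn_integral (fun y : 'rV[R]_n' => f (row_mx (t%:M : 'M[R]_1) y)))
  end.

(** * Distributions

    An element of D'(Omega) is represented by a total functional of which only
    the values on test functions supported in Omega matter; restriction to a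
    smaller open set is thus implicit. *)

Definition distribution_carrier (R : realType) (n : nat) : Type :=
  ('rV[R]_n -> R) -> R.

Section distributions.
Context {R : realType} {n : nat}.
Implicit Types (u : distribution_carrier R n) (Omega : set 'rV[R]_n).

Definition is_distribution Omega u : Prop :=
  (forall (a : R) phi psi, test_function Omega phi -> test_function Omega psi ->
     u (fun x => a * phi x + psi x) = a * u phi + u psi) /\
  (forall K : set 'rV[R]_n, compact K -> K `<=` Omega ->
     exists (C : R) (k : nat), forall phi,
       test_function Omega phi -> closed_support phi `<=` K ->
       `|u phi| <= C * Ck_norm k phi).

Definition smooth_distribution Omega u : Prop :=
  exists f : 'rV[R]_n -> R, smooth_on Omega f /\
    forall phi, test_function Omega phi ->
      u phi = Rn_integral (fun x => f x * phi x).

Definition hypoelliptic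
    (L : distribution_carrier R n -> distribution_carrier R n) : Prop :=
  forall Omega u Omega',
    open Omega -> is_distribution Omega u ->
    open Omega' -> Omega' `<=` Omega ->
    smooth_distribution Omega' (L u) -> smooth_distribution Omega' u.

End distributions.

(** * Vector fields *)

Definition vfield (R : realType) (n : nat) : Type := 'rV[R]_n -> 'rV[R]_n.

Section vector_fields.
Context {R : realType} {n : nat}.
Implicit Types (X Y Z : 'rV[R]_n -> 'rV[R]_n) (S : set ('rV[R]_n -> 'rV[R]_n)).

Definition vf_app X (u : 'rV[R]_n -> R) : 'rV[R]_n -> R :=
  fun x => \sum_i X x 0 i * pderiv i u x.

Definition vf_bracket X Y : 'rV[R]_n -> 'rV[R]_n :=
  fun x => \row_j (vf_app X (fun y => Y y 0 j) x - vf_app Y (fun y => X y 0 j) x).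

Definition lie_subalgebra S : Prop :=
  [/\ S 0,
      forall (a : R) Y Z, S Y -> S Z -> S (a *: Y + Z) &
      forall Y Z, S Y -> S Z -> S (vf_bracket Y Z)].

Definition lie_generated {m : nat} (X : 'I_m -> vfield R n) :
    set ('rV[R]_n -> 'rV[R]_n) :=
  smallest lie_subalgebra (range X).

Definition vf_transpose X (phi : 'rV[R]_n -> R) : 'rV[R]_n -> R :=
  fun x => - \sum_i pderiv i (fun y => X y 0 i * phi y) x.

Definition vf_distr X (u : distribution_carrier R n) : distribution_carrier R n :=
  fun phi => u (vf_transpose X phi).

(** X_I = X_(i_1) ... X_(i_k), acting on distributions. *)
Definition vf_monomial {m : nat} (X : 'I_m -> vfield R n) (I : seq 'I_m)
    (u : distribution_carrier R n) : distribution_carrier R n :=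
  foldr (fun i => vf_distr (X i)) u I.

(** L = \sum_(|I| = nu) c_I X_I. As all the degrees are positive, |I| = nu
    forces the length of I to be at most nu. *)
Definition diff_op {m : nat} (X : 'I_m -> vfield R n) (degs : 'I_m -> nat)
    (nu : nat) (c : seq 'I_m -> R) (u : distribution_carrier R n) :
    distribution_carrier R n :=
  fun phi => \sum_(k < nu.+1)
    \sum_(I : k.-tuple 'I_m | (\sum_(i <- I) degs i == nu)%N)
      c I * vf_monomial X I u phi.

Definition dilation (sigma : 'I_n -> nat) (lambda : R) (x : 'rV[R]_n) :
    'rV[R]_n :=
  \row_i (lambda ^+ sigma i * x 0 i).

Definition vf_homogeneous (sigma : 'I_n -> nat) (d : nat) X : Prop :=
  forall (lambda : R) (u : 'rV[R]_n -> R), 0 < lambda -> smooth_on setT u ->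
    forall x, vf_app X (u \o dilation sigma lambda) x =
              lambda ^+ d * vf_app X u (dilation sigma lambda x).

End vector_fields.

(** * Linear algebra in a (possibly infinite-dimensional) vector space *)

Section linear.
Context {R : realType} {V : lmodType R}.

Definition linearly_independent {k : nat} (v : 'I_k -> V) : Prop :=
  forall a : 'I_k -> R, \sum_i a i *: v i = 0 -> forall i, a i = 0.

Definition in_span (S : set V) (v : V) : Prop :=
  exists (k : nat) (a : 'I_k -> R) (w : 'I_k -> V),
    (forall i, S (w i)) /\ v = \sum_i a i *: w i.

(** The linear subspace [S] has dimension [k]. *)
Definition has_dim (S : set V) (k : nat) : Prop :=
  exists b : 'I_k -> V,
    [/\ forall i, S (b i), linearly_independent b &
        forall v, S v -> in_span (range b) v].

End linear.

Definition nondecreasing_degrees {k : nat} (d : 'I_k -> nat) : Prop :=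
  (forall i, (1 <= d i)%N) /\ (forall i j : 'I_k, (i <= j)%N -> (d i <= d j)%N).

(** * The assumption on the vector fields *)

Record homogeneous_hormander (R : realType) (n m : nat) (sigma : 'I_n -> nat)
    (degs : 'I_m -> nat) (X : 'I_m -> vfield R n) : Prop := {
  hh_dim_pos : (0 < n)%N;
  hh_smooth : forall j, smooth_map (X j);
  hh_independent :
    linearly_independent (X : 'I_m -> ('rV[R]_n -> 'rV[R]_n));
  hh_hormander : forall v : 'rV[R]_n,
    in_span [set Z 0 | Z in lie_generated X] v;
  hh_sigma : nondecreasing_degrees sigma;
  hh_sigma1 : forall i : 'I_n, val i = 0%N -> sigma i = 1%N;
  hh_degs : nondecreasing_degrees degs;
  hh_homogeneous : forall j, vf_homogeneous sigma (degs j) (X j)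
}.

(** * Homogeneous groups *)

Record homogeneous_group (R : realType) (N : nat) (d : 'I_N -> nat)
    (mul : 'rV[R]_N -> 'rV[R]_N -> 'rV[R]_N) (inv : 'rV[R]_N -> 'rV[R]_N) :
    Prop := {
  hg_assoc : associative mul;
  hg_unitl : left_id 0 mul;
  hg_unitr : right_id 0 mul;
  hg_invl : left_inverse 0 inv mul;
  hg_invr : right_inverse 0 inv mul;
  hg_mul_smooth :
    smooth_map (fun z : 'rV[R]_(N + N) => mul (lsubmx z) (rsubmx z));
  hg_inv_smooth : smooth_map inv;
  hg_exp_pos : forall i, (0 < d i)%N;
  hg_dilation : forall lambda : R, 0 < lambda ->
    {morph dilation d lambda : x y / mul x y}
}.

Definition hom_dim {N : nat} (d : 'I_N -> nat) : nat := (\sum_i d i)%N.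

Definition lie_of_group {R : realType} {N : nat}
    (mul : 'rV[R]_N -> 'rV[R]_N -> 'rV[R]_N) : set ('rV[R]_N -> 'rV[R]_N) :=
  [set Y | smooth_map Y /\
     forall (a : 'rV[R]_N) (u : 'rV[R]_N -> R), smooth_on setT u ->
       forall x, vf_app Y (u \o mul a) x = vf_app Y u (mul a x)].

(** * Liftings; R^(n + p) is R^n x R^p via [row_mx x xi] *)

(** The exponents of D_lambda (x, xi) = (delta_lambda x, E_lambda xi). *)
Definition cat_exponents {n p : nat} (sigma : 'I_n -> nat) (tau : 'I_p -> nat)
    (i : 'I_(n + p)) : nat :=
  match fintype.split i with inl j => sigma j | inr k => tau k end.

(** A vector field on R^n, seen as a vector field on R^n x R^p. *)
Definition vf_extend {R : realType} {n p : nat} (X : vfield R n) :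
    'rV[R]_(n + p) -> 'rV[R]_(n + p) :=
  fun z => row_mx (X (lsubmx z)) 0.

Record is_lifting (R : realType) (n m p : nat) (sigma : 'I_n -> nat)
    (degs : 'I_m -> nat) (X : 'I_m -> vfield R n) (tau : 'I_p -> nat)
    (mul : 'rV[R]_(n + p) -> 'rV[R]_(n + p) -> 'rV[R]_(n + p))
    (inv : 'rV[R]_(n + p) -> 'rV[R]_(n + p))
    (Xt : 'I_m -> vfield R (n + p)) : Prop := {
  lift_tau : nondecreasing_degrees tau;
  lift_group : homogeneous_group (cat_exponents sigma tau) mul inv;
  lift_hom_dim : (hom_dim sigma < hom_dim (cat_exponents sigma tau))%N;
  lift_left_invariant : forall j, lie_of_group mul (Xt j);
  lift_generate : lie_generated Xt = lie_of_group mul;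
  lift_homogeneous :
    forall j, vf_homogeneous (cat_exponents sigma tau) (degs j) (Xt j);
  (** "Non-vanishing" is read as: not identically zero. *)
  lift_remainder : forall j,
    exists Rj : 'rV[R]_(n + p) -> 'rV[R]_(n + p),
      [/\ smooth_map Rj, (forall z, lsubmx (Rj z) = 0), Rj <> 0 &
          forall z, Xt j z = vf_extend (X j) z + Rj z]
}.

(** * Generalized Rockland operators *)

(** [diff_op X degs nu c] is a generalized Rockland operator, with respect to
    the fixed lifting [tau], [mul], [inv], [Xt]. *)
Record generalized_rockland (R : realType) (n m p : nat) (sigma : 'I_n -> nat)
    (degs : 'I_m -> nat) (X : 'I_m -> vfield R n) (tau : 'I_p -> nat)
    (mul : 'rV[R]_(n + p) -> 'rV[R]_(n + p) -> 'rV[R]_(n + p))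
    (inv : 'rV[R]_(n + p) -> 'rV[R]_(n + p))
    (Xt : 'I_m -> vfield R (n + p)) (nu : nat) (c : seq 'I_m -> R) : Prop := {
  gr_assumption : homogeneous_hormander sigma degs X;
  gr_dim : has_dim (lie_generated X) (n + p);
  gr_p_pos : (1 <= p)%N;
  gr_lifting : is_lifting sigma degs X tau mul inv Xt;
  gr_hypoelliptic : hypoelliptic (diff_op Xt degs nu c)
}.

(* Main.v *)
(** Lift a distribution [u] on [Omega] to [u (x) 1] on [Omega x R^p], that is,
    [phi |-> u (fun x => \int phi (x, xi) dxi)]. Since the components of the
    lifted fields along [R^n] are those of the [X j] and do not depend on [xi],
    while a [xi]-derivative of a test function integrates to zero, the lifted
    operator maps [u (x) 1] to [(L u) (x) 1]. The latter is smooth where [L u]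
    is, so by hypoellipticity [u (x) 1] is given by a smooth function [F], and
    testing against [phi (x) psi] with [\int psi = 1] shows that [u] is given by
    [x |-> \int F (x, xi) psi xi dxi]. *)

Require Import Defs.
From mathcomp Require Import all_boot all_order all_algebra.
From mathcomp Require Import all_classical all_reals all_analysis.
From mathcomp Require Import ring lra.

Set Implicit Arguments.
Unset Strict Implicit.
Unset Printing Implicit Defensive.

Import Order.TTheory GRing.Theory Num.Theory.
Import numFieldNormedType.Exports.

Local Open Scope classical_set_scope.
Local Open Scope ring_scope.

(** Integrals are iterated one-dimensional Lebesgue integrals, and no exchange of integrals ever
    occurs: in [row_mx x xi] the [x]-variables are the outer ones, so integrating over the fibre
    first is what the definition already does. The analytic core is differentiation in [x] under the
    fibre integral. It does without dominated convergence: every integrand is jointly continuous and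
    vanishes for [xi] outside one box common to all parameters, so compactness yields uniform
    estimates. That a [xi]-derivative integrates to zero is then an induction on coordinates, closed
    by the fundamental theorem of calculus. The lift of [u] must be shown to be a distribution
    before hypoellipticity applies. The seminorm order is preserved, since an [x]-derivative of a
    fibre integral is the fibre integral of a derivative of the same order. The function [F] of the
    overview need not be integrable along the fibres, hence the cut-off [psi], a product of bumps
    built from exp(-1/t). *)

(** * Compactly supported integrals on the line, and their dependence on a parameter *)

Section real_integrals.
Context {R : realType}.
Notation mu := (@lebesgue_measure R).
Implicit Types (f g : R -> R) (M : R).

(** The radius is explicit so that a single bound can serve a whole family of functions. *)
Definition supported_in M f := forall t, M < `|t| -> f t = 0.

Lemma supported_in_restrict M f :
  supported_in M f -> f = f \_ `[- M, M].
Proof.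
move=> f0; apply/funext => t; rewrite patchE; case: ifPn => // /negP tM.
rewrite f0// ltNge; apply/negP => tM'; apply: tM.
by rewrite inE /= in_itv /= -ler_norml.
Qed.

Lemma supported_integrable M f :
  continuous f -> supported_in M f -> mu.-integrable setT (EFin \o f).
Proof.
move=> cf f0.
have := @continuous_compact_integrable R f `[- M, M] (@segment_compact _ _ _).
move=> /(_ (continuous_subspaceT cf)); move/integrable_mkcond => /(_ _).
rewrite restrict_EFin -supported_in_restrict//; apply; exact: measurable_itv.
Qed.

Lemma supported_Rintegral M f : supported_in M f ->
  Rintegral mu setT f = Rintegral mu `[- M, M] f.
Proof. by move=> f0; rewrite [RHS]Rintegral_mkcond -supported_in_restrict. Qed.

Lemma supported_Rintegral_bound M B f : 0 <= M ->
    continuous f -> supported_in M f -> (forall t, `|f t| <= B) ->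
  `|Rintegral mu setT f| <= (M + M) * B.
Proof.
move=> M0 cf f0 fB; rewrite (supported_Rintegral f0).
have intf : mu.-integrable `[- M, M] (EFin \o f).
  by apply: (integrableS _ _ _ (supported_integrable cf f0)) => //.
apply: (le_trans (le_normr_Rintegral _ intf)) => //.
apply: (@le_trans _ _ (Rintegral mu `[- M, M] (fun=> B))).
  apply: le_Rintegral => //; first exact: (integrable_norm intf).
  exact: continuous_compact_integrable (@segment_compact _ _ _)
    (continuous_subspaceT (fun x => cvg_cst _)).
rewrite Rintegral_cst//= lebesgue_measure_itv /= lte_fin.
(* A degenerate interval has measure 0; the bound is then nonnegative because [B] dominates a
   norm. *)
case: ifPn => _ /=; first by rewrite opprK mulrC.
by rewrite mulr0 mulr_ge0 ?addr_ge0// (le_trans _ (fB 0)).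
Qed.

Lemma pos_gt M : exists2 N, 0 < N & M < N.
Proof.
exists (`|M| + 1); first by rewrite ltr_wpDl.
by rewrite (le_lt_trans (ler_norm M))// ltrDl.
Qed.

Lemma continuous_slice (T S : topologicalType) (H : T -> S -> R) x t :
  {for (x, t), continuous (fun z : T * S => H z.1 z.2)} ->
  {for t, continuous (H x)}.
Proof.
move=> cH; have := @continuous_comp _ _ _ (fun s : S => (x, s))
  (fun z : T * S => H z.1 z.2) t; apply => //.
by apply: cvg_pair => //; exact: cvg_cst.
Qed.

(** Joint continuity is uniform over a compact interval, so the integrands, and with them the
    integrals, are uniformly close for nearby parameters. *)
Lemma continuous_Rintegral_param (T : topologicalType) (U : set T) M
    (H : T -> R -> R) : open U ->
    (forall x t, U x -> {for (x, t), continuous (fun z : T * R => H z.1 z.2)}) ->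
    (forall x, U x -> supported_in M (H x)) ->
  forall x, U x -> {for x, continuous (fun y => Rintegral mu setT (H y))}.
Proof.
move=> oU cH sH x Ux; have [N N0 MN] := pos_gt M.
have sHN y : U y -> supported_in N (H y).
  by move=> Uy t Nt; apply: (sH y Uy); exact: lt_trans Nt.
have cs y : U y -> continuous (H y).
  by move=> Uy t; apply: continuous_slice; exact: cH.
(* The interval [[- N, N]] has length [N + N], so a uniform gap [d] moves the integral by at most
   [e]. *)
apply/cvgrPdist_le => e e0; pose d := e / (N + N).
have d0 : 0 < d by rewrite divr_gt0 ?addr_gt0.
have near_d : \forall y \near x, `[- N, N] `<=` (fun t => `|H x t - H y t| <= d).
  (* By compactness it is enough to take [s] near one [t] and [y] near [x]; there [H x s] and
     [H y s] both lie within [d / 2] of [H x t]. *)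
  have /compact_near_coveringP := @segment_compact R (- N) N.
  apply => t _.
  have /cvgrPdist_lt/(_ _ (divr_gt0 d0 (ltr0Sn _ 1))) := cH x t Ux.
  move=> -[[A B] /= [xA tB] AB].
  exists (B, A) => //= -[s y] [/= Bs Ay].
  have := AB (y, s) (conj Ay Bs); have := AB (x, s) (conj (nbhs_singleton xA) Bs).
  move=> /= h1 h2; rewrite (_ : _ - _ = (H x t - H y s) - (H x t - H x s)); last by ring.
  by rewrite (le_trans (ler_normB _ _))// [leRHS](splitr d) lerD// ltW.
have nearU : \forall y \near x, U y by exact: open_nbhs_nbhs.
near=> y.
have Uy : U y by near: y.
have yd : `[- N, N] `<=` (fun t => `|H x t - H y t| <= d) by near: y.
rewrite -RintegralB//; last 2 first.
- exact: supported_integrable (cs _ Ux) (sHN _ Ux).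
- exact: supported_integrable (cs _ Uy) (sHN _ Uy).
have sB : supported_in N (fun t => H x t - H y t).
  by move=> t Nt; rewrite !sHN ?subr0.
have := @supported_Rintegral_bound N d _ (ltW N0) _ sB.
rewrite /d mulrCA divff ?mulr1; last by rewrite gt_eqF ?addr_gt0.
apply.
  by move=> t; apply: cvgB; exact: cs.
move=> t; have [tN|/sB->] := leP `|t| N; last by rewrite normr0 ltW.
by apply: yd; rewrite /= in_itv /= -ler_norml.
Unshelve. all: by end_near. Qed.

(** Fundamental theorem of calculus on [[- N, N]]. The strict inequality [M < N] makes [f] vanish at
    the end points; [supported_in] says nothing where the norm of [t] equals [M]. *)
Lemma Rintegral_derivative_eq0 M (f df : R -> R) :
    (forall t : R, is_derive t 1 f (df t)) -> continuous df -> supported_in M f ->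
  Rintegral mu setT df = 0.
Proof.
move=> fdf cdf sf; have [N N0 MN] := pos_gt M.
have fc : continuous f.
  by move=> t; apply: differentiable_continuous; apply/derivable1_diffP; case: (fdf t).
(* Around a point beyond [N] the function [f] is zero on an open set, so its derivative vanishes
   there. *)
have sdf : supported_in N df.
  move=> t Nt; case: (fdf t) => _ <-.
  rewrite (@near_eq_derive _ _ _ f (cst 0)) ?derive_cst//.
  have: (fun s => N < `|s|) t by [].
  have oN : open [set s : R | N < `|s|].
    exact: (open_comp (fun x _ => @norm_continuous _ _ x) (@open_gt R N)).
  by move=> tN; near=> s; apply: sf; apply: (lt_trans MN); near: s;
    apply: (open_nbhs_nbhs (A := [set s : R | N < `|s|])).
rewrite (supported_Rintegral sdf) /Rintegral (@continuous_FTC2 _ _ f)//.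
- by rewrite /= !sf ?subrr// ?normrN (gtr0_norm N0).
- by rewrite gtrN.
- exact: continuous_subspaceT.
- split.
  + by move=> t _; case: (fdf t).
  + exact: cvg_at_right_filter (fc _).
  + exact: cvg_at_left_filter (fc _).
- by move=> t _; rewrite derive1E; case: (fdf t).
Unshelve. all: by end_near. Qed.

End real_integrals.

(** * Pointwise continuity of pairs, sums, products, rows and submatrices *)

Lemma continuous_pair (T S1 S2 : topologicalType) (f : T -> S1) (g : T -> S2) x :
  {for x, continuous f} -> {for x, continuous g} ->
  {for x, continuous (fun y => (f y, g y))}.
Proof. by move=> cf cg; exact: (cvg_pair cf cg). Qed.

Lemma open_setX (T S : topologicalType) (A : set T) (B : set S) :
  open A -> open B -> open (A `*` B).
Proof.
rewrite !openE => oA oB [x y] [/= Ax By].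
by exists (A, B) => //; split; [exact: oA|exact: oB].
Qed.

Lemma continuous_at_cst (T S : topologicalType) (c : S) (x : T) :
  {for x, continuous (fun _ : T => c)}.
Proof. exact: cvg_cst. Qed.

Lemma continuous_at_id (T : topologicalType) (x : T) : {for x, continuous (@id T)}.
Proof. exact: cvg_id. Qed.

Arguments continuous_at_cst {T S} c x.
Arguments continuous_at_id {T} x.

Lemma near_eq_continuous (T S : topologicalType) (f g : T -> S) x :
  {near x, f =1 g} -> {for x, continuous f} -> {for x, continuous g}.
Proof.
move=> fg cf; rewrite /prop_for /continuous_at -(nbhs_singleton fg).
exact: cvg_trans (near_eq_cvg fg) cf.
Qed.

Lemma continuous_mulrl (R : realType) (T : topologicalType) (a : R) (g : T -> R) :
  continuous g -> continuous (fun x => a * g x).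
Proof. by move=> cg x; apply: cvgM; [exact: cvg_cst|exact: cg]. Qed.

Lemma continuous_addr (R : realType) (T : topologicalType) (f g : T -> R) :
  continuous f -> continuous g -> continuous (fun x => f x + g x).
Proof. by move=> cf cg x; apply: cvgD; [exact: cf|exact: cg]. Qed.

Lemma continuous_at_add (R : realType) (T : topologicalType) (f g : T -> R) x :
  {for x, continuous f} -> {for x, continuous g} ->
  {for x, continuous (fun y => f y + g y)}.
Proof. by move=> cf cg; exact: cvgD. Qed.

Lemma continuous_at_mul (R : realType) (T : topologicalType) (f g : T -> R) x :
  {for x, continuous f} -> {for x, continuous g} ->
  {for x, continuous (fun y => f y * g y)}.
Proof. by move=> cf cg; exact: cvgM. Qed.

Section matrix_continuity.
Context {R : realType}.

Lemma continuous_mx (T : topologicalType) m n (f : T -> 'M[R]_(m, n)) x :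
  (forall i j, {for x, continuous (fun y => f y i j)}) -> {for x, continuous f}.
Proof.
move=> cf A [P fP sub].
have : \forall y \near x, forall i j, P i j (f y i j).
  by apply: filter_forall => i; apply: filter_forall => j; exact: (cf i j _ (fP i j)).
by apply: filterS => y Py; exact: sub.
Qed.

Lemma continuous_row_mx (T : topologicalType) n1 n2 (f : T -> 'rV[R]_n1)
    (g : T -> 'rV[R]_n2) x : {for x, continuous f} -> {for x, continuous g} ->
  {for x, continuous (fun y => row_mx (f y) (g y))}.
Proof.
move=> cf cg; apply: continuous_mx => i j; rewrite -(splitK j).
case: (fintype.split j) => k /=.
  under [X in {for _, continuous X}]funext do rewrite row_mxEl.
  exact: (continuous_comp (g := fun M : 'rV[R]_n1 => M i k) cf (@coord_continuous _ _ _ _ _ _)).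
under [X in {for _, continuous X}]funext do rewrite row_mxEr.
exact: (continuous_comp (g := fun M : 'rV[R]_n2 => M i k) cg (@coord_continuous _ _ _ _ _ _)).
Qed.

Lemma continuous_scalar1 (T : topologicalType) (f : T -> R) x :
  {for x, continuous f} -> {for x, continuous (fun y => (f y)%:M : 'M[R]_1)}.
Proof.
move=> cf; apply: continuous_mx => i j.
by under [X in {for _, continuous X}]funext do rewrite mxE !ord1 mulr1n.
Qed.

Lemma continuous_lsubmx n1 n2 : continuous (@lsubmx R 1 n1 n2).
Proof.
move=> x; apply: continuous_mx => i j.
under [X in {for _, continuous X}]funext do rewrite mxE.
exact: coord_continuous.
Qed.

Lemma continuous_rsubmx n1 n2 : continuous (@rsubmx R 1 n1 n2).
Proof.
move=> x; apply: continuous_mx => i j.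
under [X in {for _, continuous X}]funext do rewrite mxE.
exact: coord_continuous.
Qed.

End matrix_continuity.

(** * Continuity, linearity, bounds and splitting of the iterated integral *)

Section iterated_integrals.
Context {R : realType}.
Notation mu := (@lebesgue_measure R).

(** A box rather than a ball: slices inherit the same [M], which suits induction on the
    dimension. *)
Definition box_supported p (M : R) (g : 'rV[R]_p -> R) :=
  forall (xi : 'rV[R]_p) k, M < `|xi 0 k| -> g xi = 0.

Lemma box_supported_slice p M (g : 'rV[R]_p.+1 -> R) (t : R) :
  box_supported M g ->
  box_supported M (fun y : 'rV[R]_p => g (row_mx (t%:M : 'M[R]_1) y)).
Proof.
move=> sg y k yk; apply: (sg _ (rshift 1 k)).
by rewrite (row_mxEr (t%:M : 'M[R]_1)).
Qed.

Lemma box_supported_slice0 p M (g : 'rV[R]_p.+1 -> R) (t : R) y :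
  box_supported M g -> M < `|t| -> g (row_mx (t%:M : 'M[R]_1) y) = 0.
Proof.
move=> sg tM; apply: (sg _ (lshift p (0 : 'I_1))).
by rewrite (row_mxEl (t%:M : 'M[R]_1)) mxE eqxx mulr1n.
Qed.

Lemma Rn_integral0 p : Rn_integral (fun _ : 'rV[R]_p => 0 : R) = 0.
Proof.
elim: p => //= p IH; under eq_Rintegral do rewrite IH.
by rewrite Rintegral_cst// mul0r.
Qed.

Lemma Rn_integral_eq0 p (g : 'rV[R]_p -> R) : (forall x, g x = 0) -> Rn_integral g = 0.
Proof. by move=> g0; rewrite (_ : g = fun=> 0) ?Rn_integral0//; exact/funext. Qed.

(** Induction on [p] for all parameter spaces at once: the outer integration variable joins the
    parameter, so the inner integral is handled over [T * R] and the open set [U] times the line. *)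
Lemma continuous_Rn_integral p (T : topologicalType) (U : set T) M
    (G : T -> 'rV[R]_p -> R) : open U ->
    (forall x xi, U x ->
       {for (x, xi), continuous (fun z : T * 'rV[R]_p => G z.1 z.2)}) ->
    (forall x, U x -> box_supported M (G x)) ->
  forall x, U x -> {for x, continuous (fun y => Rn_integral (G y))}.
Proof.
elim: p => [|p IH] in T U G *; move=> oU cG sG x Ux.
  have := @continuous_comp _ _ _ (fun y : T => (y, 0 : 'rV[R]_0))
    (fun z => G z.1 z.2) x; apply; last exact: cG.
  by apply: (@continuous_pair T T 'rV[R]_0 id (fun=> 0)) => //; exact: cvg_cst.
apply: (continuous_Rintegral_param (U := U) (M := M)) => //= {x Ux} x.
  move=> t Ux; pose K (z : T * R) (y : 'rV[R]_p) :=
    G z.1 (row_mx (z.2%:M : 'M[R]_1) y).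
  apply: (IH (T * R)%type (U `*` setT) K) => //.
  - by apply: open_setX => //; exact: openT.
  - move=> [x' t'] xi [/= Ux' _].
    have := @continuous_comp _ _ _
      (fun w : T * R * 'rV[R]_p =>
        (w.1.1, row_mx (w.1.2%:M : 'M[R]_1) w.2 : 'rV[R]_p.+1))
      (fun z => G z.1 z.2) ((x', t'), xi); apply; last exact: cG.
    apply: continuous_pair => /=.
      exact: (continuous_comp (f := fst) (g := fst) (@cvg_fst _ _ _ _ _) (@cvg_fst _ _ _ _ _)).
    apply: (@continuous_row_mx _ _ _ _ (fun w : T * R * 'rV[R]_p => w.1.2%:M : 'M[R]_1) snd).
      apply: continuous_scalar1.
      exact: (continuous_comp (f := fst) (g := snd) (@cvg_fst _ _ _ _ _) (@cvg_snd _ _ _ _ _)).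
    exact: cvg_snd.
  - by move=> [x' t'] [/= Ux' _]; exact: box_supported_slice (sG _ Ux').
move=> Ux t tM; apply: Rn_integral_eq0 => y.
exact: box_supported_slice0 (sG _ Ux) tM.
Qed.

Section slices.
Context {p : nat} {M : R}.
Implicit Types g h : 'rV[R]_p.+1 -> R.

Let slice g (t : R) := Rn_integral (fun y : 'rV[R]_p => g (row_mx (t%:M : 'M[R]_1) y)).

Lemma continuous_slice_cons g (t : R) : continuous g ->
  continuous (fun y : 'rV[R]_p => g (row_mx (t%:M : 'M[R]_1) y)).
Proof.
move=> cg y; apply: (continuous_comp (g := g)); last exact: cg.
exact: (@continuous_row_mx R 'rV[R]_p 1 p (fun=> t%:M : 'M[R]_1) id y (continuous_at_cst _ _) (continuous_at_id _)).
Qed.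

Lemma continuous_cons_joint g : continuous g ->
  continuous (fun z : R * 'rV[R]_p => g (row_mx (z.1%:M : 'M[R]_1) z.2)).
Proof.
move=> cg z.
have := @continuous_comp _ _ _
  (fun z : R * 'rV[R]_p => row_mx (z.1%:M : 'M[R]_1) z.2 : 'rV[R]_p.+1) g z.
apply; last exact: cg.
apply: (@continuous_row_mx R (R * 'rV[R]_p)%type 1 p
  (fun z : R * 'rV[R]_p => z.1%:M : 'M[R]_1) snd).
  by apply: continuous_scalar1; exact: cvg_fst.
exact: cvg_snd.
Qed.

Lemma continuous_Rn_slice g : continuous g -> box_supported M g ->
  continuous (slice g).
Proof.
move=> cg sg t; apply: (continuous_Rn_integral (U := setT) (M := M)) => //.
- exact: openT.
- by move=> x xi _; exact: continuous_cons_joint.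
- by move=> x _; exact: box_supported_slice.
Qed.

Lemma supported_Rn_slice g : box_supported M g -> supported_in M (slice g).
Proof.
move=> sg t tM; apply: Rn_integral_eq0 => y.
exact: box_supported_slice0 sg tM.
Qed.

Lemma integrable_Rn_slice g : continuous g -> box_supported M g ->
  mu.-integrable setT (EFin \o slice g).
Proof.
by move=> cg sg; exact: supported_integrable (continuous_Rn_slice cg sg)
  (supported_Rn_slice sg).
Qed.

End slices.

Lemma Rn_integralD p M (g h : 'rV[R]_p -> R) :
    continuous g -> box_supported M g -> continuous h -> box_supported M h ->
  Rn_integral (fun x => g x + h x) = Rn_integral g + Rn_integral h.
Proof.
elim: p => //= p IH in g h * => cg sg ch sh.
rewrite -RintegralD//; try exact: (@integrable_Rn_slice p M _).
apply: eq_Rintegral => t _; apply: IH;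
  by [exact: continuous_slice_cons|exact: box_supported_slice].
Qed.

Lemma Rn_integralZ p M a (g : 'rV[R]_p -> R) :
    continuous g -> box_supported M g ->
  Rn_integral (fun x => a * g x) = a * Rn_integral g.
Proof.
elim: p => //= p IH in g * => cg sg.
rewrite -RintegralZl//; try exact: (@integrable_Rn_slice p M _).
apply: eq_Rintegral => t _; apply: IH;
  by [exact: continuous_slice_cons|exact: box_supported_slice].
Qed.

Lemma Rn_integral_sum p M (I : Type) (r : seq I) (g : I -> 'rV[R]_p -> R) :
    (forall i, continuous (g i)) -> (forall i, box_supported M (g i)) ->
  Rn_integral (fun x => \sum_(i <- r) g i x) = \sum_(i <- r) Rn_integral (g i).
Proof.
move=> cg sg; elim: r => [|i r IH].
  by rewrite big_nil; apply: Rn_integral_eq0 => x; rewrite big_nil.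
rewrite big_cons -IH -(Rn_integralD (M := M))//.
- by congr Rn_integral; apply/funext => x; rewrite big_cons.
- by apply: continuous_big => //; exact: add_continuous.
- by move=> x k xk; rewrite big1// => j _; exact: sg xk.
Qed.

(** The factor is the volume of the box, one length [M + M] per integration. *)
Lemma Rn_integral_bound p M B (g : 'rV[R]_p -> R) : 0 <= M ->
    continuous g -> box_supported M g -> (forall x, `|g x| <= B) ->
  `|Rn_integral g| <= (M + M) ^+ p * B.
Proof.
move=> M0; elim: p => [|p IH] /= in g * => cg sg gB.
  by rewrite expr0 mul1r.
rewrite exprS -mulrA; apply: supported_Rintegral_bound => //.
- exact: continuous_Rn_slice cg sg.
- exact: supported_Rn_slice sg.
- move=> t; apply: IH => //.
  + exact: continuous_slice_cons.
  + exact: box_supported_slice.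
Qed.

(** The first [n] coordinates are the outer integrations by definition, so the induction only
    reassociates rows and no Fubini theorem enters. *)
Lemma Rn_integral_split n p (f : 'rV[R]_(n + p) -> R) :
  Rn_integral f =
  Rn_integral (fun x : 'rV[R]_n => Rn_integral (fun xi => f (row_mx x xi))).
Proof.
elim: n => [|n IH] /= in f *.
  congr Rn_integral; apply/funext => x; congr f; apply/rowP => i.
  rewrite -(splitK (i : 'I_(0 + p))); case: (fintype.split _) => [[]//|k] /=.
  by rewrite row_mxEr; congr (x _ _); exact: val_inj.
apply: eq_Rintegral => t _.
rewrite (IH (fun y : 'rV[R]_(n + p) => f (row_mx (t%:M : 'M[R]_1) y))).
congr Rn_integral; apply/funext => x; congr Rn_integral; apply/funext => xi.
(* The cast inserted by [row_mxA] relates two convertible dimensions and is therefore the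
   identity. *)
congr f; rewrite (@row_mxA _ 1 1 n p); exact: castmx_id.
Qed.

End iterated_integrals.

(** * Differentiation under the integral sign *)

Section differentiation_under_integral.
Context {R : realType}.
Notation mu := (@lebesgue_measure R).

(** Mean value theorem to the left or to the right of [a], according to the sign of [h]. It trades a
    quotient, singular at [h = 0], for a value of [df] close to [a]. *)
Lemma difference_quotient_MVT (f df : R -> R) (a e h : R) :
    (forall t, ball a e t -> is_derive t 1 f (df t)) -> `|h| < e -> h != 0 ->
  exists2 c, `|c - a| <= `|h| & h^-1 * (f (h + a) - f a) = df c.
Proof.
move=> fdf he h0.
have inb (t : R) : `|t - a| <= `|h| -> ball a e t.
  by move=> ta; rewrite /ball /= distrC (le_lt_trans ta).
have fc (t : R) : `|t - a| <= `|h| -> {for t, continuous f}.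
  move=> /inb /fdf [ft _]; apply: differentiable_continuous.
  exact/derivable1_diffP.
have key b c : b < c -> (forall t, t \in `[b, c] -> `|t - a| <= `|h|) ->
    exists2 t, t \in `]b, c[%R & f c - f b = df t * (c - b).
  move=> bc bch; apply: MVT => // [t tbc|].
    by apply/fdf/inb/bch; exact: subset_itv_oo_cc tbc.
  apply: continuous_in_subspaceT => t tbc; apply: fc; apply: bch.
  by move: tbc; rewrite inE.
move: h0; rewrite neq_lt => /orP[h0|h0].
  have [||t tb E] := key (h + a) a.
  - by rewrite gtrDr.
  - move=> t; rewrite in_itv /= => /andP[t1 t2].
    rewrite ler0_norm ?subr_le0// (ltr0_norm h0); lra.
  exists t; last first.
    rewrite (_ : f (h + a) - f a = df t * h); last by lra.
    by rewrite mulrCA mulVf ?mulr1// lt_eqF.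
  move: tb; rewrite in_itv /= => /andP[t1 t2].
  rewrite ler0_norm ?subr_le0 1?ltW// (ltr0_norm h0); lra.
have [||t tb E] := key a (h + a).
- by rewrite ltrDr.
- move=> t; rewrite in_itv /= => /andP[t1 t2].
  rewrite ger0_norm ?subr_ge0// (gtr0_norm h0); lra.
exists t; last by rewrite E addrK mulrCA mulVf ?mulr1// gt_eqF.
move: tb; rewrite in_itv /= => /andP[t1 t2].
rewrite ger0_norm ?subr_ge0 1?ltW// (gtr0_norm h0); lra.
Qed.

(* The difference quotient, extended by the derivative at [h = 0], is jointly
   continuous, so that this reduces to continuity of parameter integrals. *)
Lemma is_derive_Rn_integral p (U : set R) M (G dG : R -> 'rV[R]_p -> R) a :
    open U -> U a ->
    (forall h xi, U h -> is_derive h 1 (G^~ xi) (dG h xi)) ->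
    (forall h xi, U h ->
       {for (h, xi), continuous (fun z : R * 'rV[R]_p => G z.1 z.2)}) ->
    (forall h xi, U h ->
       {for (h, xi), continuous (fun z : R * 'rV[R]_p => dG z.1 z.2)}) ->
    (forall h, U h -> box_supported M (G h)) ->
    (forall h, U h -> box_supported M (dG h)) ->
  is_derive a 1 (fun h => Rn_integral (G h)) (Rn_integral (dG a)).
Proof.
move=> oU Ua GdG cG cdG sG sdG.
have [e /= e0 eU] : nbhs_ball a U by rewrite nbhs_ballE; exact: open_nbhs_nbhs.
pose q (h : R) (xi : 'rV[R]_p) :=
  if h == 0 then dG a xi else h^-1 * (G (h + a) xi - G a xi).
have Ush h : `|h| < e -> U (h + a).
  by move=> he; apply: eU; rewrite /ball /= opprD addrCA subrr addr0 normrN.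
have cga xi : {for xi, continuous (G a)} by apply: continuous_slice (cG _ _ Ua).
have cq h xi : ball 0 e h ->
    {for (h, xi), continuous (fun z : R * 'rV[R]_p => q z.1 z.2)}.
  rewrite /ball /= sub0r normrN => he.
  have [->|h0] := eqVneq h 0; last first.
    pose q' (z : R * 'rV[R]_p) := z.1^-1 * (G (z.1 + a) z.2 - G a z.2).
    have nz : \forall z \near (h, xi), z.1 != 0.
      have: nbhs h [set t : R | t != 0] by apply: open_nbhs_nbhs; split => //;
        exact: open_neq.
      exact: (@cvg_fst _ _ (nbhs h) (nbhs xi)).
    have qq' : {near (h, xi), q' =1 fun z => q z.1 z.2}.
      by apply: filterS nz => z z0; rewrite /q (negbTE z0).
    apply: (near_eq_continuous qq').
    apply: cvgM; first by apply: cvgV => //; exact: cvg_fst.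
    apply: cvgB.
      have := @continuous_comp _ _ _ (fun z : R * 'rV[R]_p => (z.1 + a, z.2))
        (fun z => G z.1 z.2) (h, xi); apply; last by apply: cG; exact: Ush.
      apply: continuous_pair; last exact: cvg_snd.
      by apply: cvgD; [exact: cvg_fst|exact: cvg_cst].
    exact: (@continuous_comp _ _ _ (@snd R 'rV[R]_p) (G a) (h, xi) (@cvg_snd _ _ _ _ _) (cga xi)).
  apply/cvgrPdist_lt => eps eps0.
  have /cvgrPdist_lt/(_ _ eps0) := cdG a xi Ua.
  move=> -[[A B] /= [aA xiB] AB].
  have [d /= d0 dA] : nbhs_ball a A by rewrite nbhs_ballE.
  (* Radius [e] keeps the segment inside [U], where the mean value theorem applies; radius [d]
     forces the mean value point into [A], where [dG] is close to [dG a xi]. *)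
  exists (ball 0 (Num.min d e), B).
    by split => //=; apply: nbhsx_ballx; rewrite lt_min d0.
  move=> [h' xi'] [/=]; rewrite /ball /= sub0r normrN lt_min => /andP[hd h'e] Bxi.
  rewrite /q eqxx; case: ifPn => [_|h'0].
    exact: (AB (a, xi') (conj (nbhs_singleton aA) Bxi)).
  have [t th ->] := @difference_quotient_MVT (G^~ xi') (dG^~ xi') a e h'
    (fun t te => GdG t xi' (eU _ te)) h'e h'0.
  apply: (AB (t, xi')); split => //=; apply: dA.
  by rewrite /ball /= distrC (le_lt_trans th).
have sq h : ball 0 e h -> box_supported M (q h).
  rewrite /ball /= sub0r normrN => he xi k xik; rewrite /q; case: ifPn => _.
    exact: (sdG a Ua _ _ xik).
  by rewrite (sG _ (Ush _ he) _ _ xik) (sG _ Ua _ _ xik) subrr mulr0.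
have cI := @continuous_Rn_integral R p R (ball 0 e) M q (@ball_open _ _ _ _) cq sq.
have {}cI := cI 0 (ballxx _ e0).
have cga' : continuous (G a) by [].
(* Away from 0 the difference quotient of the integral is the integral of [q], so its limit is read
   off from the continuity [cI] at 0. *)
have E : {near 0^', (fun h => Rn_integral (q h)) =1
    (fun h : R => h^-1 *: (((fun h => Rn_integral (G h)) \o shift a) (h *: 1) -
       Rn_integral (G a)))}.
  near=> h.
  have h0 : h != 0 by near: h; exact: nbhs_dnbhs_neq.
  have he : `|h| < e by near: h; exact: dnbhs0_lt.
  rewrite /= -[h *: 1]/(h * 1) mulr1 -[_ *: _]/(_ * _).
  have cgh : continuous (G (h + a)).
    by move=> xi; apply: continuous_slice (cG _ _ (Ush _ he)).
  rewrite -mulN1r -(Rn_integralZ (M := M))//; last exact: sG.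
  rewrite -(Rn_integralD (M := M))//; last 3 first.
  - exact/sG/Ush.
  - exact: continuous_mulrl.
  - by move=> x k xk; rewrite (sG _ Ua _ _ xk) mulr0.
  rewrite -(Rn_integralZ (M := M))//; last 2 first.
  - by apply: continuous_addr => //; exact: continuous_mulrl.
  - move=> x k xk; rewrite (sG _ Ua _ _ xk) mulr0 addr0.
    exact: (sG _ (Ush _ he) _ _ xk).
  by congr Rn_integral; apply/funext => x; rewrite /q (negbTE h0) mulN1r.
have lim : (fun h : R => h^-1 *: (((fun h => Rn_integral (G h)) \o shift a) (h *: 1) -
       Rn_integral (G a))) @ 0^' --> Rn_integral (dG a).
  have -> : dG a = q 0 by apply/funext => xi; rewrite /q eqxx.
  apply: (cvg_trans (near_eq_cvg E)).
  exact: cvg_trans (cvg_app _ (@cvg_within _ _ _ _)) cI.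
apply: DeriveDef; first by apply/cvg_ex; exists (Rn_integral (dG a)).
exact: cvg_lim lim.
Unshelve. all: by end_near. Qed.

End differentiation_under_integral.

(** * Directional derivatives along lines, and integrals of partial derivatives *)

Section partial_derivatives.
Context {R : realType}.
Notation mu := (@lebesgue_measure R).

(** Both sides are limits of literally the same difference quotient. This is the bridge between
    partial derivatives and one-variable calculus. *)
Lemma is_derive_line (V : normedModType R) (f : V -> R) (x v : V) (h d : R) :
  is_derive h 1 (fun t : R => f (t *: v + x)) d <-> is_derive (h *: v + x) v f d.
Proof.
have E : (fun t : R => t^-1 *: (((fun t : R => f (t *: v + x)) \o shift h) (t *: 1)
      - f (h *: v + x))) =
    (fun t : R => t^-1 *: ((f \o shift (h *: v + x)) (t *: v) - f (h *: v + x))).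
  apply/funext => t /=; congr (_ *: (f _ - _)).
  by rewrite scalerDl -[t *: 1]/(t * 1) mulr1 addrA.
split=> -[D1 D2]; apply: DeriveDef.
- by rewrite /derivable -E.
- by rewrite /derive -E.
- by rewrite /derivable E.
- by rewrite /derive E.
Qed.

Lemma is_derive_line0 (V : normedModType R) (f : V -> R) (x v : V) (d : R) :
  is_derive (0 : R) 1 (fun t : R => f (t *: v + x)) d -> is_derive x v f d.
Proof. by move/is_derive_line; rewrite scale0r add0r. Qed.

Lemma row_mx_shiftl n p (h : R) (i : 'I_n) (x : 'rV[R]_n) (y : 'rV[R]_p) :
  h *: delta_mx 0 (lshift p i) + row_mx x y = row_mx (h *: delta_mx 0 i + x) y.
Proof.
apply/rowP => j; rewrite -(splitK j); case: (fintype.split j) => k /=.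
  by rewrite mxE !row_mxEl !mxE eq_lshift.
by rewrite mxE !row_mxEr !mxE eq_rlshift andbF mulr0 add0r.
Qed.

Lemma row_mx_shiftr n p (h : R) (i : 'I_p) (x : 'rV[R]_n) (y : 'rV[R]_p) :
  h *: delta_mx 0 (rshift n i) + row_mx x y = row_mx x (h *: delta_mx 0 i + y).
Proof.
apply/rowP => j; rewrite -(splitK j); case: (fintype.split j) => k /=.
  by rewrite mxE !row_mxEl !mxE eq_lrshift andbF mulr0 add0r.
by rewrite mxE !row_mxEr !mxE eq_rshift.
Qed.

Lemma is_derive_row_mxl n p (f : 'rV[R]_(n + p) -> R) (i : 'I_n) x y d :
  is_derive (row_mx x y) (delta_mx 0 (lshift p i) : 'rV[R]_(n + p)) f d <->
  is_derive x (delta_mx 0 i : 'rV[R]_n) (fun x => f (row_mx x y)) d.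
Proof.
have := is_derive_line f (row_mx x y) (delta_mx 0 (lshift p i)) 0 d.
rewrite scale0r add0r => <-.
have := is_derive_line (fun x => f (row_mx x y)) x (delta_mx 0 i) 0 d.
rewrite scale0r add0r => <-.
by under [X in is_derive _ _ X]eq_fun do rewrite row_mx_shiftl.
Qed.

Lemma is_derive_row_mxr n p (f : 'rV[R]_(n + p) -> R) (i : 'I_p) x y d :
  is_derive (row_mx x y) (delta_mx 0 (rshift n i) : 'rV[R]_(n + p)) f d <->
  is_derive y (delta_mx 0 i : 'rV[R]_p) (fun y => f (row_mx x y)) d.
Proof.
have := is_derive_line f (row_mx x y) (delta_mx 0 (rshift n i)) 0 d.
rewrite scale0r add0r => <-.
have := is_derive_line (fun y => f (row_mx x y)) y (delta_mx 0 i) 0 d.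
rewrite scale0r add0r => <-.
by under [X in is_derive _ _ X]eq_fun do rewrite row_mx_shiftr.
Qed.

Lemma open_coord_gt n (k : 'I_n) (M : R) : open [set x : 'rV[R]_n | M < `|x 0 k|].
Proof.
have c : continuous (fun x : 'rV[R]_n => `|x 0 k|).
  move=> x; apply: (continuous_comp (f := fun x : 'rV[R]_n => x 0 k) (g := Num.norm)).
    exact: coord_continuous.
  exact: norm_continuous.
exact: (open_comp (fun x _ => c x) (@open_gt R M)).
Qed.

Lemma pderiv_eq0 n (A : set 'rV[R]_n) (f : 'rV[R]_n -> R) i x :
  open A -> A x -> (forall y, A y -> f y = 0) -> pderiv i f x = 0.
Proof.
move=> oA Ax f0; rewrite /pderiv (@near_eq_derive _ _ _ f (cst 0)) ?derive_cst//.
by apply: filterS (open_nbhs_nbhs (conj oA Ax)) => y; exact: f0.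
Qed.

Lemma box_supported_pderiv p M (g : 'rV[R]_p -> R) i :
  box_supported M g -> box_supported M (pderiv i g).
Proof.
move=> sg x k xk; apply: (@pderiv_eq0 p _ g i x (@open_coord_gt p k M)) => //= y.
exact: sg.
Qed.

(** If [k] is the outermost coordinate, the derivative is moved outside the inner integral and the
    one-dimensional case applies; otherwise the inner integral vanishes by induction. *)
Lemma Rn_integral_pderiv_eq0 p M (f : 'rV[R]_p -> R) (k : 'I_p) :
    continuous f -> continuous (pderiv k f) ->
    (forall x, derivable f x (delta_mx 0 k : 'rV[R]_p)) -> box_supported M f ->
  Rn_integral (pderiv k f) = 0.
Proof.
elim: p => [|p IH] in f k *; first by case: k.
move=> cf cdf df sf /=; have sdf := box_supported_pderiv k sf.
case kj : (@fintype.split 1 p k) => [j|j].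
  have kE : lshift p j = k by rewrite -[RHS](@splitK 1 p) kj.
  apply: (@Rintegral_derivative_eq0 _ M (fun t =>
    Rn_integral (fun y : 'rV[R]_p => f (row_mx (t%:M : 'M[R]_1) y)))).
  - move=> t; apply: (@is_derive_Rn_integral R p setT M
      (fun t y => f (row_mx (t%:M : 'M[R]_1) y))
      (fun t y => pderiv k f (row_mx (t%:M : 'M[R]_1) y))) => //.
    + exact: openT.
    + move=> h xi _.
      (* Seen as a row of length 1, the outer variable runs along the line through 0 in direction
         [delta_mx 0 j], so its derivative is a directional one. *)
      have E s : (s%:M : 'M[R]_1) = s *: delta_mx 0 j + 0.
        by apply/matrixP => a b; rewrite !mxE !ord1 eqxx mulr1 addr0 mulr1n.
      have H : is_derive (row_mx (h%:M : 'M[R]_1) xi) (delta_mx 0 (lshift p j) : 'rV[R]_(1 + p)) f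
          (pderiv k f (row_mx (h%:M : 'M[R]_1) xi)).
        by rewrite kE; exact/derivableP/df.
      move/(@is_derive_row_mxl 1 p) : H; rewrite E => /is_derive_line.
      by under [X in is_derive _ _ X]eq_fun do rewrite -E.
    + by move=> h xi _; exact: continuous_cons_joint.
    + by move=> h xi _; exact: continuous_cons_joint.
    + by move=> h _; exact: box_supported_slice.
    + by move=> h _; exact: box_supported_slice.
  - exact: continuous_Rn_slice cdf sdf.
  - exact: supported_Rn_slice sf.
(* Here [k] is an inner coordinate, and the inner integral is zero for every fixed [t]. *)
have kE : rshift 1 j = k by rewrite -[RHS](@splitK 1 p) kj.
under eq_Rintegral => t _.
  rewrite (_ : Rn_integral _ = 0); first over.
  have dE y : is_derive (y : 'rV[R]_p) (delta_mx 0 j : 'rV[R]_p)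
      (fun y => f (row_mx (t%:M : 'M[R]_1) y)) (pderiv k f (row_mx (t%:M : 'M[R]_1) y)).
    apply/(@is_derive_row_mxr 1 p); rewrite kE; exact/derivableP/df.
  have E : (fun y => pderiv k f (row_mx (t%:M : 'M[R]_1) y)) =
      pderiv j (fun y : 'rV[R]_p => f (row_mx (t%:M : 'M[R]_1) y)).
    by apply/funext => y; case: (dE y).
  rewrite E; apply: IH => [||y|].
  - exact: continuous_slice_cons.
  - by rewrite -E; exact: continuous_slice_cons.
  - by case: (dE y).
  - exact: box_supported_slice.
by rewrite Rintegral_cst// mul0r.
Qed.

End partial_derivatives.

(** * Closure properties of smooth functions *)

Section smooth_functions.
Context {R : realType}.

Section one_space.
Context {n : nat}.
Implicit Types (f g : 'rV[R]_n -> R) (Omega : set 'rV[R]_n).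

Lemma open_near (T : topologicalType) (A : set T) (P : T -> Prop) x :
  open A -> A x -> (forall y, A y -> P y) -> \forall y \near x, P y.
Proof. by move=> oA Ax AP; apply: filterS (open_nbhs_nbhs (conj oA Ax)). Qed.

Lemma smooth_on_subset Omega Omega' f :
  Omega' `<=` Omega -> smooth_on Omega f -> smooth_on Omega' f.
Proof. by move=> sub sf s x /sub; exact: sf. Qed.

(** [pderivs] applies the last index of its list first, so a derivative taken beforehand is appended
    on the right. *)
Lemma smooth_on_pderiv Omega f i : smooth_on Omega f -> smooth_on Omega (pderiv i f).
Proof.
by move=> sf s x Ox; have := sf (rcons s i) x Ox; rewrite /pderivs foldr_rcons.
Qed.

Lemma smooth_on_pderivs Omega f s : smooth_on Omega f -> smooth_on Omega (pderivs s f).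
Proof. by move=> sf; elim: s => //= i s; exact: smooth_on_pderiv. Qed.

Lemma smooth_continuous Omega f x : smooth_on Omega f -> Omega x ->
  {for x, continuous f}.
Proof. by move=> sf Ox; case: (sf [::] x Ox). Qed.

Lemma smoothT_continuous f : smooth_on setT f -> continuous f.
Proof. by move=> sf x; exact: smooth_continuous sf _. Qed.

Lemma smooth_derivable Omega f x i : smooth_on Omega f -> Omega x ->
  derivable f x (delta_mx 0 i : 'rV[R]_n).
Proof. by move=> sf Ox; case: (sf [::] x Ox). Qed.

Lemma smooth_is_derive Omega f x i : smooth_on Omega f -> Omega x ->
  is_derive x (delta_mx 0 i : 'rV[R]_n) f (pderiv i f x).
Proof. by move=> sf Ox; apply/derivableP; exact: smooth_derivable sf Ox. Qed.

(** Coinduction principle that replaces explicit formulas for iterated derivatives. Each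
    [pderivs s f] keeps a representative in [C]; the two agree only on [Omega], whose openness lets
    the equality be differentiated once more. *)
Lemma smooth_on_coind Omega (C : set ('rV[R]_n -> R)) : open Omega ->
    (forall f, C f -> forall x, Omega x -> {for x, continuous f}) ->
    (forall f, C f -> forall i, exists2 g, C g &
       forall x, Omega x -> is_derive x (delta_mx 0 i : 'rV[R]_n) f (g x)) ->
  forall f, C f -> smooth_on Omega f.
Proof.
move=> oO Cc Cd f Cf.
have key s : exists2 g, C g & forall x, Omega x -> pderivs s f x = g x.
  elim: s => [|i s [g Cg fg]]; first by exists f.
  have [g' Cg' gg'] := Cd g Cg i; exists g' => // x Ox /=.
  have [_ <-] := gg' x Ox; apply: near_eq_derive.
  exact: open_near oO Ox fg.
move=> s x Ox; have [g Cg fg] := key s.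
have gf : {near x, g =1 pderivs s f} by apply: (open_near oO Ox) => y /fg.
split; first exact: near_eq_continuous gf (Cc g Cg x Ox).
move=> i; apply: near_eq_derivable gf _.
by have [g' _ /(_ x Ox)[]] := Cd g Cg i.
Qed.

Lemma smooth_on_cst Omega (c : R) : smooth_on Omega (fun=> c).
Proof.
apply: (@smooth_on_subset setT) => //.
apply: (@smooth_on_coind setT [set f | exists c, f = fun=> c]) => [|f [{}c ->]|f [{}c ->]|].
- exact: openT.
- by move=> x _; exact: continuous_at_cst.
- by move=> i; exists (fun=> 0); [exists 0|move=> x _; exact: is_derive_cst].
- by exists c.
Qed.

(** By the Leibniz rule products alone are not stable under differentiation, but sums and products
    together are; so [smooth_on_coind] applies without a higher-order Leibniz formula. *)
Inductive smooth_algebra Omega : set ('rV[R]_n -> R) :=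
| smooth_algebra_gen f of smooth_on Omega f : smooth_algebra Omega f
| smooth_algebra_add f g of smooth_algebra Omega f & smooth_algebra Omega g :
    smooth_algebra Omega (fun x => f x + g x)
| smooth_algebra_mul f g of smooth_algebra Omega f & smooth_algebra Omega g :
    smooth_algebra Omega (fun x => f x * g x).

Lemma smooth_algebra_smooth Omega f : open Omega ->
  smooth_algebra Omega f -> smooth_on Omega f.
Proof.
move=> oO; apply: (smooth_on_coind oO) => {f} f; elim => {f}.
- by move=> f sf x Ox; exact: smooth_continuous sf Ox.
- by move=> f g _ cf _ cg x Ox; exact: (continuous_at_add (cf x Ox) (cg x Ox)).
- by move=> f g _ cf _ cg x Ox; exact: (continuous_at_mul (cf x Ox) (cg x Ox)).
- move=> f sf i; exists (pderiv i f).
    by apply: smooth_algebra_gen; exact: smooth_on_pderiv.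
  by move=> x Ox; exact: smooth_is_derive sf Ox.
- move=> f g _ df _ dg i; have [f' Cf' ff'] := df i; have [g' Cg' gg'] := dg i.
  exists (fun x => f' x + g' x); first exact: smooth_algebra_add.
  by move=> x Ox; apply: is_deriveD; [exact: ff'|exact: gg'].
- move=> f g Cf df Cg dg i; have [f' Cf' ff'] := df i; have [g' Cg' gg'] := dg i.
  exists (fun x => f x * g' x + g x * f' x).
    by apply: smooth_algebra_add; exact: smooth_algebra_mul.
  by move=> x Ox; apply: is_deriveM; [exact: ff'|exact: gg'].
Qed.

Lemma smooth_onD Omega f g : open Omega -> smooth_on Omega f -> smooth_on Omega g ->
  smooth_on Omega (fun x => f x + g x).
Proof.
move=> oO sf sg; apply: smooth_algebra_smooth => //.
by apply: smooth_algebra_add; exact: smooth_algebra_gen.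
Qed.

Lemma smooth_onM Omega f g : open Omega -> smooth_on Omega f -> smooth_on Omega g ->
  smooth_on Omega (fun x => f x * g x).
Proof.
move=> oO sf sg; apply: smooth_algebra_smooth => //.
by apply: smooth_algebra_mul; exact: smooth_algebra_gen.
Qed.

Lemma smooth_on_sum Omega (I : Type) (r : seq I) (f : I -> 'rV[R]_n -> R) :
  open Omega -> (forall i, smooth_on Omega (f i)) ->
  smooth_on Omega (fun x => \sum_(i <- r) f i x).
Proof.
move=> oO sf; elim: r => [|i r IH].
  under eq_fun do rewrite big_nil; exact: smooth_on_cst.
under eq_fun do rewrite big_cons; exact: smooth_onD.
Qed.

Lemma smooth_on_prod Omega (I : Type) (r : seq I) (f : I -> 'rV[R]_n -> R) :
  open Omega -> (forall i, smooth_on Omega (f i)) ->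
  smooth_on Omega (fun x => \prod_(i <- r) f i x).
Proof.
move=> oO sf; elim: r => [|i r IH].
  under eq_fun do rewrite big_nil; exact: smooth_on_cst.
under eq_fun do rewrite big_cons; exact: smooth_onM.
Qed.

End one_space.

(** Since [A] sends basis vectors to basis vectors or to 0, a partial derivative of [g \o A] is 0 or
    a partial derivative of [g] composed with [A]; no chain rule sum appears. Both coordinate
    projections are of this kind. *)
Lemma smooth_on_comp_linear n N (A : {linear 'rV[R]_N -> 'rV[R]_n})
    (Omega : set 'rV[R]_n) (g : 'rV[R]_n -> R) :
    open Omega -> continuous A ->
    (forall k, A (delta_mx 0 k) = 0 \/ exists i, A (delta_mx 0 k) = delta_mx 0 i) ->
  smooth_on Omega g -> smooth_on (A @^-1` Omega) (g \o A).
Proof.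
move=> oO cA Ad sg.
apply: (@smooth_on_coind _ _ [set f | exists2 g, smooth_on Omega g & f = g \o A]);
  last by exists g.
- by apply: open_comp => // x _; exact: cA.
- move=> _ [f sf ->] x Ox; apply: continuous_comp; first exact: cA.
  exact: smooth_continuous sf Ox.
- move=> _ [f sf ->] k.
  have line x d : is_derive (A x) (A (delta_mx 0 k)) f d ->
      is_derive x (delta_mx 0 k : 'rV[R]_N) (f \o A) d.
    move=> H; apply: is_derive_line0 => /=.
    under [X in is_derive _ _ X]eq_fun do rewrite linearP.
    by apply/(is_derive_line f (A x)); rewrite scale0r add0r.
  case: (Ad k) => [Ak0|[i Aki]].
    exists (fun=> 0); first by exists (fun=> 0) => //; exact: smooth_on_cst.
    move=> x Ox; apply: line; rewrite Ak0.
    by apply: DeriveDef; [exact: derivable0|rewrite derive0].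
  exists (pderiv i f \o A); first by exists (pderiv i f) => //; exact: smooth_on_pderiv.
  by move=> x Ox; apply: line; rewrite Aki; exact: smooth_is_derive sf Ox.
Qed.

Lemma smooth_on_lsubmx n p (Omega : set 'rV[R]_n) (g : 'rV[R]_n -> R) :
  open Omega -> smooth_on Omega g ->
  smooth_on (@lsubmx R 1 n p @^-1` Omega) (fun z => g (lsubmx z)).
Proof.
move=> oO sg; apply: smooth_on_comp_linear => //; first exact: continuous_lsubmx.
move=> k; rewrite -(splitK k); case: (fintype.split k) => j /=; [right; exists j|left];
  by apply/rowP => i; rewrite !mxE ?eq_lshift ?eq_lrshift ?andbF.
Qed.

Lemma smooth_on_rsubmx n p (g : 'rV[R]_p -> R) : smooth_on setT g ->
  smooth_on setT (fun z => g (@rsubmx R 1 n p z)).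
Proof.
move=> sg; apply: (smooth_on_comp_linear (Omega := setT)) => //.
- exact: openT.
- exact: continuous_rsubmx.
move=> k; rewrite -(splitK k); case: (fintype.split k) => j /=; [left|right; exists j];
  by apply/rowP => i; rewrite !mxE ?eq_rshift ?eq_rlshift ?andbF.
Qed.

End smooth_functions.

(** * Integration along the fibres of the projection to the first [n] coordinates *)

Section partial_integrals.
Context {R : realType} {n p : nat}.
Implicit Types (F : 'rV[R]_(n + p) -> R) (Omega : set 'rV[R]_n).

Definition partial_integral F (x : 'rV[R]_n) : R :=
  Rn_integral (fun xi : 'rV[R]_p => F (row_mx x xi)).

Definition slab Omega : set 'rV[R]_(n + p) := @lsubmx R 1 n p @^-1` Omega.

(** Only [xi] is bounded, uniformly in [x]: a smooth function on the cylinder multiplied by a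
    cut-off in [xi] satisfies this without having compact support. *)
Definition fiber_supported Omega M F :=
  forall x, Omega x -> box_supported M (fun xi : 'rV[R]_p => F (row_mx x xi)).

Lemma open_slab Omega : open Omega -> open (slab Omega).
Proof. by move=> oO; apply: open_comp => // x _; exact: continuous_lsubmx. Qed.

Lemma slab_row_mx Omega x xi : Omega x -> slab Omega (row_mx x xi).
Proof. by move=> Ox; rewrite /slab /= row_mxKl. Qed.

Lemma fiber_supported_pderiv Omega M F i : open Omega ->
  fiber_supported Omega M F -> fiber_supported Omega M (pderiv i F).
Proof.
move=> oO sF x Ox xi k xik.
apply: (@pderiv_eq0 _ _ (slab Omega `&` [set z | M < `|z 0 (rshift n k)|])).
- by apply: openI; [exact: open_slab|exact: open_coord_gt].
- by split; [exact: slab_row_mx|rewrite /= row_mxEr].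
- move=> z [Oz zk]; rewrite -(hsubmxK z); apply: (sF _ Oz _ k).
  by rewrite mxE.
Qed.

Lemma continuous_row_mx_joint F x xi : {for row_mx x xi, continuous F} ->
  {for (x, xi), continuous (fun z : 'rV[R]_n * 'rV[R]_p => F (row_mx z.1 z.2))}.
Proof.
move=> cF; have := @continuous_comp _ _ _
  (fun z : 'rV[R]_n * 'rV[R]_p => row_mx z.1 z.2) F (x, xi); apply => //.
by apply: continuous_row_mx; [exact: cvg_fst|exact: cvg_snd].
Qed.

Lemma smooth_fiber_continuous Omega F x : smooth_on (slab Omega) F -> Omega x ->
  continuous (fun xi : 'rV[R]_p => F (row_mx x xi)).
Proof.
move=> sF Ox xi.
apply: (@continuous_slice R _ _ (fun (x : 'rV[R]_n) (xi : 'rV[R]_p) => F (row_mx x xi))).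
apply: continuous_row_mx_joint; apply: smooth_continuous sF _; exact: slab_row_mx.
Qed.

Lemma continuous_partial_integral Omega M F x : open Omega ->
    smooth_on (slab Omega) F -> fiber_supported Omega M F -> Omega x ->
  {for x, continuous (partial_integral F)}.
Proof.
move=> oO sF fF Ox.
apply: (@continuous_Rn_integral R p _ Omega M (fun x xi => F (row_mx x xi))) => //.
move=> y xi Oy; apply: continuous_row_mx_joint.
by apply: smooth_continuous sF _; exact: slab_row_mx.
Qed.

(** Restriction to the line [l] through [x] reduces this to differentiation under the integral in
    one variable, over the open set of [h] with [l h] in [Omega]. *)
Lemma is_derive_partial_integral Omega M F x i : open Omega ->
    smooth_on (slab Omega) F -> fiber_supported Omega M F -> Omega x ->
  is_derive x (delta_mx 0 i : 'rV[R]_n) (partial_integral F)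
    (partial_integral (pderiv (lshift p i) F) x).
Proof.
move=> oO sF fF Ox; apply: is_derive_line0.
pose l (h : R) : 'rV[R]_n := h *: delta_mx 0 i + x.
have cl : continuous l.
  move=> h; apply: continuous_mx => a b.
  have -> : (fun y => l y a b) = fun y : R => y * (delta_mx 0 i : 'rV[R]_n) a b + x a b.
    by apply/funext => y; rewrite !mxE.
  apply: continuous_at_add; last exact: continuous_at_cst.
  by apply: continuous_at_mul; [exact: continuous_at_id|exact: continuous_at_cst].
have cG (H : 'rV[R]_(n + p) -> R) (h : R) (xi : 'rV[R]_p) :
    smooth_on (slab Omega) H -> Omega (l h) ->
    {for (h, xi), continuous (fun z : R * 'rV[R]_p => H (row_mx (l z.1) z.2))}.
  move=> sH Oh.
  have := @continuous_comp _ _ _ (fun z : R * 'rV[R]_p => (l z.1, z.2))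
    (fun z : 'rV[R]_n * 'rV[R]_p => H (row_mx z.1 z.2)) (h, xi); apply.
    apply: continuous_pair; last exact: cvg_snd.
    exact: (@continuous_comp _ _ _ (@fst R 'rV[R]_p) l (h, xi) (@cvg_fst _ _ _ _ _) (cl h)).
  apply: continuous_row_mx_joint; apply: smooth_continuous sH _; exact: slab_row_mx.
have l0 : l 0 = x by rewrite /l scale0r add0r.
rewrite -[in X in is_derive _ _ _ X]l0.
apply: (@is_derive_Rn_integral R p (l @^-1` Omega) M (fun h xi => F (row_mx (l h) xi))
  (fun h xi => pderiv (lshift p i) F (row_mx (l h) xi)) 0).
- by apply: open_comp => // h _; exact: cl.
- by rewrite /= l0.
- move=> h xi Oh; apply/(is_derive_line (fun y => F (row_mx y xi)) x).
  apply/is_derive_row_mxl; apply: smooth_is_derive sF _; exact: slab_row_mx.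
- by move=> h xi Oh; exact: cG.
- by move=> h xi Oh; apply: cG => //; exact: smooth_on_pderiv.
- by move=> h Oh; exact: fF.
- by move=> h Oh; exact: (@fiber_supported_pderiv Omega M F (lshift p i) oO fF _ Oh).
Qed.

Lemma pderiv_partial_integral Omega M F x i : open Omega ->
    smooth_on (slab Omega) F -> fiber_supported Omega M F -> Omega x ->
  pderiv i (partial_integral F) x = partial_integral (pderiv (lshift p i) F) x.
Proof.
by move=> oO sF fF Ox; have [] := is_derive_partial_integral i oO sF fF Ox.
Qed.

(** Partial integrals with a fixed fibre bound [M] are stable under partial derivatives, because
    each derivative passes to the integrand and keeps [M]. *)
Lemma smooth_partial_integral Omega M F : open Omega ->
    smooth_on (slab Omega) F -> fiber_supported Omega M F ->
  smooth_on Omega (partial_integral F).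
Proof.
move=> oO sF fF; apply: (@smooth_on_coind _ _ _
  [set f | exists F, [/\ smooth_on (slab Omega) F, fiber_supported Omega M F &
                         f = partial_integral F]]) => //; last by exists F.
- by move=> _ [G [sG fG ->]] x Ox; exact: continuous_partial_integral sG fG Ox.
- move=> _ [G [sG fG ->]] i; exists (partial_integral (pderiv (lshift p i) G)).
    exists (pderiv (lshift p i) G); split => //; first exact: smooth_on_pderiv.
    exact: fiber_supported_pderiv.
  by move=> x Ox; exact: is_derive_partial_integral sG fG Ox.
Qed.

Lemma pderivs_partial_integral M F s : smooth_on setT F -> fiber_supported setT M F ->
  pderivs s (partial_integral F) =
    partial_integral (pderivs (map (lshift p) s) F).
Proof.
move=> sF fF; elim: s => //= i s ->; apply/funext => x.
apply: (@pderiv_partial_integral setT M) => //; first exact: openT.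
  exact: smooth_on_pderivs.
elim: s => //= j s IH; apply: fiber_supported_pderiv => //; exact: openT.
Qed.

End partial_integrals.

(** * Supports and test functions *)

Section test_functions.
Context {R : realType}.

Lemma closed_support_sub n (K : set 'rV[R]_n) (f : 'rV[R]_n -> R) :
  closed K -> (forall x, ~ K x -> f x = 0) -> closed_support f `<=` K.
Proof.
move=> cK f0; rewrite [K](closure_id K).1//; apply: closureS => x /= fx.
by apply: contrapT => /f0 fx0; rewrite fx0 eqxx in fx.
Qed.

Lemma closed_support_eq0 n (f : 'rV[R]_n -> R) x : ~ closed_support f x -> f x = 0.
Proof.
by move=> nx; apply: contrapT => /eqP fx; apply: nx; exact: subset_closure.
Qed.

Lemma closed_supportS n (f g : 'rV[R]_n -> R) :
  (forall x, f x = 0 -> g x = 0) -> closed_support g `<=` closed_support f.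
Proof.
move=> fg; apply: closed_support_sub; first exact: closed_closure.
by move=> x /closed_support_eq0 /fg.
Qed.

Lemma closed_support_pderiv n (f : 'rV[R]_n -> R) i :
  closed_support (pderiv i f) `<=` closed_support f.
Proof.
apply: closed_support_sub; first exact: closed_closure.
move=> x nx; apply: (@pderiv_eq0 _ _ (~` closed_support f)) => //.
- exact/closed_openC/closed_closure.
- by move=> y; exact: closed_support_eq0.
Qed.

Lemma closed_support_pderivs n (f : 'rV[R]_n -> R) s :
  closed_support (pderivs s f) `<=` closed_support f.
Proof.
by elim: s => //= i s; apply: subset_trans; exact: closed_support_pderiv.
Qed.

Lemma compact_closed_support n (K : set 'rV[R]_n) (f : 'rV[R]_n -> R) :
  compact K -> closed_support f `<=` K -> compact (closed_support f).
Proof. by move=> cK; apply: subclosed_compact => //; exact: closed_closure. Qed.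

Lemma test_functionS n (A B : set 'rV[R]_n) f :
  A `<=` B -> test_function A f -> test_function B f.
Proof. by move=> AB [sf cf fA]; split => //; exact: subset_trans AB. Qed.

Lemma normr_coord_le n (x : 'rV[R]_n) k : `|x 0 k| <= `|x|.
Proof.
rewrite [leRHS]mx_normrE.
exact: (le_bigmax 0 (fun ij : 'I_1 * 'I_n => `|x ij.1 ij.2|) (0, k)).
Qed.

(** The bound depends on [K] alone, so it serves at once for a test function, its derivatives and
    its products with coefficients. *)
Lemma compact_fiber_supported n p (K : set 'rV[R]_(n + p)) : compact K ->
  exists2 M, 0 <= M & forall F, closed_support F `<=` K -> fiber_supported setT M F.
Proof.
move=> /compact_bounded[M [_ KM]].
have [N N0 MN] := pos_gt M; exists N; first exact: ltW.
move=> F FK x _ xi k xik; apply: closed_support_eq0 => /FK /(KM N MN) /=.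
move=> /(le_trans (normr_coord_le _ (rshift n k))).
by rewrite row_mxEr leNgt xik.
Qed.

Lemma compact_support_bounded n (f : 'rV[R]_n -> R) : continuous f ->
  compact (closed_support f) -> exists B, forall x, `|f x| <= B.
Proof.
move=> cf csf.
have /compact_bounded[B [_ KB]] : compact (f @` closed_support f).
  by apply: continuous_compact => //; exact: continuous_subspaceT.
have [N N0 BN] := pos_gt B; exists N => x.
have [sx|/closed_support_eq0->] := pselect (closed_support f x).
  by apply: (KB N BN); exists x.
by rewrite normr0 ltW.
Qed.

End test_functions.

(** * The lift of a distribution, its continuity, and transposes of lifted fields *)

Section lifted_distribution.
Context {R : realType} {n p : nat}.
Implicit Types (phi : 'rV[R]_(n + p) -> R) (Omega : set 'rV[R]_n).

Lemma compact_lsubmx_image (K : set 'rV[R]_(n + p)) : compact K ->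
  compact (@lsubmx R 1 n p @` K) /\ closed (@lsubmx R 1 n p @` K).
Proof.
move=> cK; have cK' : compact (@lsubmx R 1 n p @` K).
  apply: continuous_compact => //; apply: continuous_subspaceT.
  exact: continuous_lsubmx.
by split => //; apply: compact_closed => //; exact: norm_hausdorff.
Qed.

Lemma closed_support_partial_integral (K : set 'rV[R]_(n + p)) phi : compact K ->
  closed_support phi `<=` K ->
  closed_support (partial_integral phi) `<=` @lsubmx R 1 n p @` K.
Proof.
move=> cK phiK; apply: closed_support_sub; first exact: (compact_lsubmx_image cK).2.
move=> x nx; apply: Rn_integral_eq0 => xi; apply: closed_support_eq0 => /phiK Kx.
by apply: nx; exists (row_mx x xi); rewrite ?row_mxKl.
Qed.

Lemma smooth_slabT phi : smooth_on setT phi -> smooth_on (slab setT) phi.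
Proof. exact: smooth_on_subset. Qed.

Lemma test_partial_integral Omega phi :
  test_function (slab Omega) phi -> test_function Omega (partial_integral phi).
Proof.
move=> [sphi cphi phiO].
have sub := closed_support_partial_integral cphi (@subset_refl _ _).
split.
- have [M _ /(_ phi (@subset_refl _ _)) fphi] := compact_fiber_supported cphi.
  apply: (smooth_partial_integral _ _ fphi); first exact: openT.
  exact: smooth_slabT.
- exact: compact_closed_support (compact_lsubmx_image cphi).1 sub.
- by move=> x /sub[z /phiO zO <-].
Qed.

Lemma smooth_vf_transpose N (X : 'rV[R]_N -> 'rV[R]_N) f :
  smooth_map X -> smooth_on setT f -> smooth_on setT (vf_transpose X f).
Proof.
move=> sX sf; rewrite /vf_transpose; under eq_fun do rewrite -mulN1r.
apply: smooth_onM; [exact: openT|exact: smooth_on_cst|].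
apply: smooth_on_sum; first exact: openT.
by move=> i; apply: smooth_on_pderiv; apply: smooth_onM => //; exact: openT.
Qed.

Lemma test_vf_transpose N (X : 'rV[R]_N -> 'rV[R]_N) (A : set 'rV[R]_N) f :
  smooth_map X -> test_function A f -> test_function A (vf_transpose X f).
Proof.
move=> sX [sf cf fA].
have sub : closed_support (vf_transpose X f) `<=` closed_support f.
  apply: closed_support_sub; first exact: closed_closure.
  move=> x nx; rewrite /vf_transpose big1 ?oppr0// => i _; apply: closed_support_eq0.
  move=> /closed_support_pderiv H; apply: nx; apply: closed_supportS H => y ->.
  by rewrite mulr0.
split; first exact: smooth_vf_transpose.
- exact: compact_closed_support cf sub.
- exact: subset_trans fA.
Qed.

(* The xi-components of [Xt] contribute integrals of xi-derivatives of compactly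
   supported functions, which vanish. *)
Lemma partial_integral_transpose (Xt : 'rV[R]_(n + p) -> 'rV[R]_(n + p))
    (X : 'rV[R]_n -> 'rV[R]_n) phi : smooth_map Xt ->
    (forall z i, Xt z 0 (lshift p i) = X (lsubmx z) 0 i) ->
    smooth_on setT phi -> compact (closed_support phi) ->
  partial_integral (vf_transpose Xt phi) = vf_transpose X (partial_integral phi).
Proof.
move=> sXt XtX sphi cphi; apply/funext => x.
have [M _ fsM] := compact_fiber_supported cphi.
pose g i (z : 'rV[R]_(n + p)) := Xt z 0 i * phi z.
have sg i : smooth_on setT (g i) by apply: smooth_onM => //; exact: openT.
have fg i : fiber_supported setT M (g i).
  by apply: fsM; apply: closed_supportS => z phi0; rewrite /g phi0 mulr0.
have fdg i : fiber_supported setT M (pderiv i (g i)).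
  by apply: fiber_supported_pderiv => //; exact: openT.
have fphi : fiber_supported setT M phi by exact: fsM.
have cont (F : 'rV[R]_(n + p) -> R) : smooth_on setT F ->
    continuous (fun xi : 'rV[R]_p => F (row_mx x xi)).
  by move=> sF; apply: (smooth_fiber_continuous (smooth_slabT sF)).
have cdg i : continuous (fun xi : 'rV[R]_p => pderiv i (g i) (row_mx x xi)).
  by apply: cont; exact: smooth_on_pderiv.
rewrite /partial_integral /vf_transpose.
under [X in Rn_integral X]eq_fun do rewrite -mulN1r.
rewrite (@Rn_integralZ _ _ M); last 2 first.
- by apply: continuous_big => //; exact: add_continuous.
- by move=> xi k xik; rewrite big1// => i _; exact: (fdg i x I _ _ xik).
rewrite mulN1r; congr (- _).
rewrite (@Rn_integral_sum _ _ M)//; last by move=> i; exact: fdg.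
rewrite big_split_ord /= [X in _ + X]big1 ?addr0; last first.
  move=> k _; set d := rshift n k.
  have dE xi : is_derive (xi : 'rV[R]_p) (delta_mx 0 k : 'rV[R]_p)
      (fun xi => g d (row_mx x xi)) (pderiv d (g d) (row_mx x xi)).
    by apply/is_derive_row_mxr; exact: smooth_is_derive (sg d) _.
  have E : (fun xi => pderiv d (g d) (row_mx x xi)) =
      pderiv k (fun xi : 'rV[R]_p => g d (row_mx x xi)).
    by apply/funext => xi; case: (dE xi).
  rewrite -/(g d) E; apply: (@Rn_integral_pderiv_eq0 _ _ M).
  - exact: cont.
  - by rewrite -E.
  - by move=> xi; case: (dE xi).
  - exact: fg.
(* In an [x]-direction the derivative leaves the integral, and so does the coefficient, which
   depends on [x] alone. *)
apply: eq_bigr => i _.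
rewrite -[LHS]/(partial_integral (pderiv (lshift p i) (g (lshift p i))) x).
rewrite -(pderiv_partial_integral i openT (smooth_slabT (sg _)) (fg _) I).
congr (pderiv i _ x); apply/funext => y.
rewrite -(@Rn_integralZ _ _ M); last 2 first.
- exact: (smooth_fiber_continuous (smooth_slabT sphi)).
- exact: fphi.
by congr Rn_integral; apply/funext => xi; rewrite /g XtX row_mxKl.
Qed.

Lemma Ck_norm_term_le k N (f : 'rV[R]_N -> R) s : (size s <= k)%N ->
    (forall s, 0 <= sup (range (fun x => `|pderivs s f x|))) ->
  sup (range (fun x => `|pderivs s f x|)) <= Ck_norm k f.
Proof.
move=> sk f0; rewrite /Ck_norm; have sk' : (size s < k.+1)%N by [].
rewrite (bigD1 (Ordinal sk')) //= (bigD1 (in_tuple s)) //= -addrA lerDl.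
by apply: addr_ge0; apply: sumr_ge0 => // j _; exact: sumr_ge0.
Qed.

Lemma has_sup_test N (f : 'rV[R]_N -> R) s : test_function setT f ->
  has_sup (range (fun x => `|pderivs s f x|)).
Proof.
move=> [sf cf _]; split; first by exists `|pderivs s f 0|; exists 0.
have [||B fB] := @compact_support_bounded R N (pderivs s f).
- by apply: smoothT_continuous; exact: smooth_on_pderivs.
- exact: compact_closed_support cf (@closed_support_pderivs _ _ _ _).
by exists B => _ [x _ <-].
Qed.

Lemma sup_pderivs_ge N (f : 'rV[R]_N -> R) s x : test_function setT f ->
  `|pderivs s f x| <= sup (range (fun x => `|pderivs s f x|)).
Proof. by move=> tf; apply: sup_upper_bound; [exact: has_sup_test|exists x]. Qed.

(** Each term on the left is at most the box volume [(M + M) ^+ p] times one term of the norm of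
    [phi], hence times the whole norm; [C] sums that volume over all the terms. *)
Lemma Ck_norm_partial_integral (K : set 'rV[R]_(n + p)) k : compact K ->
  exists2 C, 0 <= C & forall phi, test_function setT phi -> closed_support phi `<=` K ->
    Ck_norm k (partial_integral phi) <= C * Ck_norm k phi.
Proof.
move=> cK; have [M M0 fsM] := compact_fiber_supported cK.
exists (\sum_(j < k.+1) \sum_(s : j.-tuple 'I_n) (M + M) ^+ p).
  by apply: sumr_ge0 => j _; apply: sumr_ge0 => s _; rewrite exprn_ge0 ?addr_ge0.
move=> phi tphi phiK; have [sphi cphi _] := tphi.
have sup0 s : 0 <= sup (range (fun x => `|pderivs s phi x|)).
  exact: le_trans (sup_pderivs_ge s 0 tphi).
rewrite mulr_suml; apply: ler_sum => j _; rewrite mulr_suml; apply: ler_sum => s _.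
apply: ge_sup; first by exists `|pderivs s (partial_integral phi) 0|; exists 0.
move=> _ [x _ <-].
rewrite (@pderivs_partial_integral _ _ _ M)//; last exact: fsM.
set t := map _ _.
apply: (@le_trans _ _ ((M + M) ^+ p * sup (range (fun x => `|pderivs t phi x|)))).
  apply: Rn_integral_bound => //.
  - by apply: (smooth_fiber_continuous (smooth_slabT _)) => //; exact: smooth_on_pderivs.
  - by apply: (fsM (pderivs t phi)) => //;
      exact: subset_trans (@closed_support_pderivs _ _ _ _) phiK.
  - by move=> xi; exact: sup_pderivs_ge.
rewrite ler_wpM2l ?exprn_ge0 ?addr_ge0//; apply: Ck_norm_term_le => //.
by rewrite size_map size_tuple -ltnS.
Qed.

Definition lift_distr (u : distribution_carrier R n) : distribution_carrier R (n + p) :=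
  fun phi => u (partial_integral phi).

Lemma is_distribution_lift Omega u :
  is_distribution Omega u -> is_distribution (slab Omega) (lift_distr u).
Proof.
move=> [ulin ucont]; split.
  move=> a phi psi tphi tpsi; rewrite /lift_distr -ulin; try exact: test_partial_integral.
  congr u; apply/funext => x; rewrite /partial_integral.
  have [sphi cphi _] := tphi; have [spsi cpsi _] := tpsi.
  (* The union of the two supports provides a common fibre bound, which additivity of the integral
     requires. *)
  have [M _ fsM] := compact_fiber_supported (compactU cphi cpsi).
  have fphi : fiber_supported setT M phi by apply: fsM; exact: subsetUl.
  have fpsi : fiber_supported setT M psi by apply: fsM; exact: subsetUr.
  have c1 := smooth_fiber_continuous (smooth_slabT sphi) (I : setT x).
  have c2 := smooth_fiber_continuous (smooth_slabT spsi) (I : setT x).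
  rewrite -(@Rn_integralZ _ _ M)//; last exact: fphi.
  rewrite -(@Rn_integralD _ _ M)//.
  - exact: continuous_mulrl.
  - by move=> xi k xik; rewrite (fphi x I _ _ xik) mulr0.
  - exact: fpsi.
move=> K cK KO; have [cK' _] := compact_lsubmx_image cK.
have [|C [k uC]] := ucont _ cK'; first by move=> _ [z /KO zO <-].
have [D D0 ID] := Ck_norm_partial_integral k cK.
(* The constant [C] may be negative; its norm can be multiplied by a further upper bound. *)
exists (`|C| * D), k => phi tphi phiK; rewrite /lift_distr.
apply: (le_trans (uC _ (test_partial_integral tphi)
  (closed_support_partial_integral cK phiK))).
have tphiT : test_function setT phi by exact: test_functionS tphi.
have tI : test_function setT (partial_integral phi).
  by apply: test_partial_integral; exact: test_functionS tphi.
have N0 : 0 <= Ck_norm k (partial_integral phi).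
  apply: sumr_ge0 => j _; apply: sumr_ge0 => s _.
  exact: le_trans (sup_pderivs_ge s 0 tI).
apply: (@le_trans _ _ (`|C| * Ck_norm k (partial_integral phi))).
  by rewrite ler_wpM2r// ler_norm.
by rewrite -mulrA ler_wpM2l// ID.
Qed.

End lifted_distribution.

(** * A smooth cut-off of integral 1 *)

Section bump.
Context {R : realType}.
Notation mu := (@lebesgue_measure R).
Implicit Types (P : {poly R}) (f : R -> R).

(** From the exponential series, y^i / i! is at most exp(y) for y nonnegative; this gives the
    constant. *)
Lemma poly_le_expR P : exists C, forall y, 0 <= y -> `|P.[y]| <= C * expR y.
Proof.
exists (\sum_(i < size P) `|P`_i| * i`!%:R) => y y0.
rewrite horner_coef mulr_suml (le_trans (ler_norm_sum _ _ _))//.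
apply: ler_sum => i _; rewrite normrM -mulrA ler_wpM2l//.
rewrite ger0_norm ?exprn_ge0//; case: (nat_of_ord i) => [|k].
  by rewrite expr0 fact0 mul1r -(expR0 R) ler_expR.
have := expR_ge1Dxn k y0; rewrite -lerBrDl => H.
rewrite mulrC -ler_pdivrMr ?ltr0n ?fact_gt0//.
by rewrite (le_trans H)// gerBl.
Qed.

(** The classical flat function P(1/x) exp(-1/x). The polynomial is carried along because repeated
    differentiation of exp(-1/x) produces such factors. *)
Definition flat P (x : R) : R := if 0 < x then P.[x^-1] * expR (- x^-1) else 0.

Lemma flat_le P : exists C, forall h, 0 < h -> `|h^-1 * flat P h| <= C * h.
Proof.
(* Of the two extra powers of 1/h, one absorbs the factor [h^-1] and the other leaves the factor [h]
   that tends to 0. *)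
have [C PC] := poly_le_expR (P * 'X^2); exists C => h h0.
have y0 : 0 <= h^-1 by rewrite invr_ge0 ltW.
have := PC _ y0; rewrite /flat h0 hornerM hornerXn => H.
have -> : h^-1 * (P.[h^-1] * expR (- h^-1)) =
    (P.[h^-1] * h^-1 ^+ 2) * expR (- h^-1) * h.
  by rewrite expr2; field; rewrite gt_eqF.
rewrite normrM (gtr0_norm h0) ler_pM2r// normrM (gtr0_norm (expR_gt0 _)).
by rewrite expRN ler_pdivrMr ?expR_gt0.
Qed.

(** With y = 1/x one has dy/dx = -y^2, so P(y) exp(-y) has derivative (P(y) - P'(y)) y^2 exp(-y), of
    the same form. At 0 the difference quotient is controlled by [flat_le]. *)
Lemma is_derive_flat P (x : R) :
  is_derive x 1 (flat P) (flat ((P - P^`()) * 'X^2) x).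
Proof.
have [x0|x0|->] := ltgtP x 0.
- rewrite [X in is_derive _ _ _ X]/flat ltNge (ltW x0) /=.
  apply: (@near_eq_is_derive _ _ _ (cst (0 : R))).
  by apply: (open_near (@open_lt R 0) x0) => y /= y0; rewrite /flat ltNge (ltW y0).
- rewrite [X in is_derive _ _ _ X]/flat x0.
  apply: (@near_eq_is_derive _ _ _ (fun y : R => P.[y^-1] * expR (- y^-1))).
    by apply: (open_near (@open_gt R 0) x0) => y /= y0; rewrite /flat y0.
  have x0' : x != 0 by rewrite gt_eqF.
  have dV : is_derive x 1 (fun y : R => y^-1) (- x ^- 2 *: 1).
    exact: (@is_deriveV _ id).
  have dP : is_derive (x^-1) 1 (horner P) (P^`().[x^-1]).
    apply: DeriveDef; first exact: derivable_horner.
    by rewrite derivE derive1E.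
  have dPV := @is_derive1_comp _ _ _ _ _ _ dP dV.
  have dE := @is_derive1_comp _ expR (fun y : R => - y^-1) x _ _
    (is_derive_expR (- x^-1)) (is_deriveN dV).
  have := @is_deriveM _ _ _ _ _ _ _ _ dPV dE.
  move=> H; apply: (is_derive_eq H).
  rewrite /= hornerM hornerD hornerN hornerXn !scalerAl /GRing.scale /=.
  by rewrite exprVn; ring.
- rewrite [X in is_derive _ _ _ X]/flat ltxx.
  have lim : (fun h : R => h^-1 *: ((flat P \o shift 0) (h *: 1) - flat P 0)) @ 0^' --> (0 : R).
    have [C PC] := flat_le P.
    apply/cvgr0Pnorm_le => e e0.
    (* [C] may be nonpositive, so a positive [D] above it serves as divisor. *)
    have [D D0 CD] := pos_gt C.
    near=> h.
    have hd : `|h| < e / D by near: h; apply: dnbhs0_lt; exact: divr_gt0.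
    rewrite /= addr0 -[h *: 1]/(h * 1) mulr1 [flat P 0]/flat ltxx subr0.
    rewrite -[_ *: _]/(_ * _).
    have [h0|h0] := leP h 0; first by rewrite /flat ltNge h0 /= mulr0 normr0 ltW.
    rewrite (le_trans (PC _ h0))//.
    rewrite gtr0_norm// in hd; rewrite ltr_pdivlMr// in hd.
    by rewrite (le_trans _ (ltW hd))// mulrC ler_wpM2l ?ltW.
  apply: DeriveDef; first by apply/cvg_ex; exists 0.
  exact: cvg_lim lim.
Unshelve. all: by end_near. Qed.

Lemma continuous_flat P : continuous (flat P).
Proof.
move=> x; apply: differentiable_continuous; apply/derivable1_diffP.
by case: (is_derive_flat P x).
Qed.

(** Scalar multiples of such functions form a stable class: differentiation multiplies [r] by [c]
    and a Kronecker delta, and changes [P]. The affine argument covers both [t] and [1 - t] in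
    [bump]. *)
Lemma smooth_flat_affine N (k : 'I_N) P (a c : R) :
  smooth_on setT (fun xi : 'rV[R]_N => flat P (c * xi 0 k + a)).
Proof.
apply: (@smooth_on_coind _ _ _
  [set f | exists r P, f = fun xi : 'rV[R]_N => r * flat P (c * xi 0 k + a)]).
- exact: openT.
- move=> _ [r [Q ->]] x _; apply: continuous_at_mul; first exact: continuous_at_cst.
  apply: (continuous_comp (f := fun xi : 'rV[R]_N => c * xi 0 k + a)); last exact: continuous_flat.
  apply: continuous_at_add; last exact: continuous_at_cst.
  apply: continuous_at_mul; [exact: continuous_at_cst|exact: coord_continuous].
- move=> _ [r [Q ->]] i.
  pose Q' := (Q - Q^`()) * 'X^2; pose d : R := (k == i)%:R.
  exists (fun xi => r * (c * d) * flat Q' (c * xi 0 k + a)); first by exists (r * (c * d)), Q'.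
  move=> x _; apply: is_derive_line0.
  have E : (fun t : R => r * flat Q (c * (t *: (delta_mx 0 i : 'rV[R]_N) + x) 0 k + a)) =
      (fun t : R => r * (flat Q \o (fun t => (c * d) * t + (c * x 0 k + a))) t).
    by apply/funext => t /=; rewrite !mxE eqxx /= -/d; congr (_ * flat Q _); ring.
  rewrite E.
  have da : is_derive (0 : R) 1 (fun t => (c * d) * t + (c * x 0 k + a)) (c * d).
    have := @is_deriveD _ _ _ _ _ (0 : R) 1 _ _
      (is_deriveZ (c * d) (is_derive_id (0 : R) (1 : R))) (is_derive_cst (c * x 0 k + a) (0 : R) (1 : R)).
    by move=> H; apply: (is_derive_eq H); rewrite addr0 /GRing.scale /= mulr1.
  have := @is_derive1_comp _ (flat Q) _ _ _ _ (is_derive_flat Q _) da.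
  move=> /(is_deriveZ r) H; apply: (is_derive_eq H).
  by rewrite mulr0 add0r /GRing.scale /= -/Q'; ring.
- by exists 1, P; apply/funext => x; rewrite mul1r.
Qed.

(** On the segment from 1/4 to 3/4, inside the open unit interval, [f] attains a positive minimum;
    the integral is at least that minimum times the length. *)
Lemma Rintegral_gt0_continuous M f : continuous f -> supported_in M f ->
  (forall t, 0 <= f t) -> (forall t, 0 < t < 1 -> 0 < f t) ->
  0 < Rintegral mu setT f.
Proof.
move=> cf sf f_ge0 f_gt0; pose A := [set` `[1 / 4 : R, 3 / 4]].
have [|c /= cA cmin] := @EVT_min R f (1 / 4) (3 / 4) _ (continuous_subspaceT cf).
  by lra.
have c0 : 0 < f c.
  by apply: f_gt0; move: cA; rewrite in_itv /= => /andP[? ?]; apply/andP; split; lra.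
have mA : measurable A by exact: measurable_itv.
have intb := supported_integrable cf sf.
have intA : mu.-integrable A (EFin \o f).
  by apply: (integrableS _ _ _ intb).
apply: (@lt_le_trans _ _ (Rintegral mu A (cst (f c)))).
  rewrite Rintegral_cst//.
  rewrite /= lebesgue_measure_itv /=.
  rewrite lte_fin ifT /=; last by lra.
  by apply: mulr_gt0 => //; lra.
apply: (@le_trans _ _ (Rintegral mu A f)).
  apply: le_Rintegral => //.
  apply: continuous_compact_integrable; first exact: segment_compact.
  by apply: continuous_subspaceT => x; exact: cvg_cst.
rewrite Rintegral_mkcond; apply: le_Rintegral => //.
  rewrite -restrict_EFin; move/integrable_mkcond : intA => /(_ _); apply.
  exact: measurable_itv.
by move=> t _; rewrite patchE; case: ifP.
Qed.

(** On the open unit interval this is exp(-1/t - 1/(1-t)); elsewhere one factor vanishes. *)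
Definition bump (t : R) : R := flat 1 t * flat 1 (1 - t).

Lemma continuous_bump : continuous bump.
Proof.
move=> t; apply: continuous_at_mul; first exact: continuous_flat.
apply: (continuous_comp (f := fun t : R => 1 - t)); last exact: continuous_flat.
by apply: cvgB; [exact: cvg_cst|exact: cvg_id].
Qed.

Lemma supported_bump : supported_in 1 bump.
Proof.
move=> t; rewrite lter_normr /bump /flat => /orP[t1|t1].
  by rewrite [0 < 1 - t]ltNge subr_le0 (ltW t1) mulr0.
by rewrite [0 < t]ltNge (_ : t <= 0) ?mul0r//; lra.
Qed.

Lemma bump_ge0 t : 0 <= bump t.
Proof.
by rewrite /bump /flat; do 2 case: ifP => _;
  rewrite ?hornerC ?mul1r ?mul0r ?mulr0// mulr_ge0 ?expR_ge0.
Qed.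

Lemma bump_gt0 t : 0 < t < 1 -> 0 < bump t.
Proof.
move=> /andP[t0 t1]; rewrite /bump /flat t0 subr_gt0 t1 !hornerC !mul1r.
by rewrite mulr_gt0 ?expR_gt0.
Qed.

(** A product of one-variable bumps normalised to integral 1; the iterated integral factors one
    coordinate at a time, down to the empty product. *)
Lemma unit_bump p : exists psi : 'rV[R]_p -> R,
  [/\ smooth_on setT psi, box_supported 1 psi & Rn_integral psi = 1].
Proof.
pose b t := (Rintegral mu setT bump)^-1 * bump t.
pose psi q (xi : 'rV[R]_q) := \prod_(k < q) b (xi 0 k).
have spsi q : smooth_on setT (psi q).
  apply: smooth_on_prod; first exact: openT.
  move=> k; apply: smooth_onM; [exact: openT|exact: smooth_on_cst|].
  rewrite /bump; apply: smooth_onM; first exact: openT.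
    have := @smooth_flat_affine q k 1 0 1.
    by under [X in smooth_on _ X]eq_fun do rewrite mul1r addr0.
  have := @smooth_flat_affine q k 1 1 (-1).
  by under [X in smooth_on _ X]eq_fun do rewrite mulN1r addrC.
have bpsi q : box_supported 1 (psi q).
  move=> xi k xik; rewrite /psi (bigD1 k)//= /b supported_bump//.
  by rewrite mulr0 mul0r.
exists (psi p); split => //; elim: p => [|p IH] /=.
  by rewrite /psi big_ord0.
under eq_Rintegral => t _.
  rewrite (_ : (fun y => _) = fun y => b t * psi p y); last first.
    apply/funext => y; rewrite /psi big_ord_recl; congr (b _ * _).
      have -> : ord0 = lshift p (0 : 'I_1) :> 'I_p.+1 by exact: val_inj.
      by rewrite (row_mxEl (t%:M : 'M[R]_1)) mxE eqxx mulr1n.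
    apply: eq_bigr => k _; congr b.
    rewrite -(row_mxEr (t%:M : 'M[R]_1) y); congr (row_mx _ _ _ _); exact: val_inj.
  rewrite (@Rn_integralZ _ _ 1)//; last exact: smoothT_continuous.
  rewrite IH mulr1; over.
rewrite RintegralZl//; last exact: supported_integrable continuous_bump supported_bump.
rewrite mulVf// gt_eqF//.
exact: Rintegral_gt0_continuous continuous_bump supported_bump bump_ge0 bump_gt0.
Qed.

End bump.

(** * The lifted operator acting on lifted distributions *)

Section lifted_operator.
Context {R : realType} {n p m : nat}.
Context {X : 'I_m -> vfield R n} {Xt : 'I_m -> vfield R (n + p)}.
Context (smooth_Xt : forall j, smooth_map (Xt j)).
Context (XtX : forall j z i, Xt j z 0 (lshift p i) = X j (lsubmx z) 0 i).

(** Peeling off the first field puts its transpose on the test function, so the induction runs over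
    all [phi]; each step commutes the transpose with the fibre integral. *)
Lemma vf_monomial_lift (I : seq 'I_m) u phi :
    smooth_on setT phi -> compact (closed_support phi) ->
  vf_monomial Xt I (lift_distr u) phi = vf_monomial X I u (partial_integral phi).
Proof.
elim: I phi => [//|i I IH] phi sphi cphi /=.
rewrite /vf_distr -(partial_integral_transpose (smooth_Xt i) (XtX i) sphi cphi).
have [//|s c _] := @test_vf_transpose _ _ _ setT phi (smooth_Xt i).
exact: IH.
Qed.

Lemma diff_op_lift degs nu c u phi :
    smooth_on setT phi -> compact (closed_support phi) ->
  diff_op Xt degs nu c (lift_distr u) phi = diff_op X degs nu c u (partial_integral phi).
Proof.
move=> sphi cphi; apply: eq_bigr => k _; apply: eq_bigr => I _.
by rewrite vf_monomial_lift.
Qed.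

End lifted_operator.

(** * Passing smoothness up to the cylinder and back down *)

Section tensor.
Context {R : realType} {n p : nat}.
Implicit Types (Omega : set 'rV[R]_n) (f : 'rV[R]_n -> R).

(** The density is constant along the fibres. Functionals are total but meaningful only on test
    functions, so [w] is compared with the lift of [v] there and not as a function. *)
Lemma smooth_distribution_lift Omega v (w : distribution_carrier R (n + p)) :
    open Omega -> smooth_distribution Omega v ->
    (forall phi, test_function (slab Omega) phi -> w phi = v (partial_integral phi)) ->
  smooth_distribution (slab Omega) w.
Proof.
move=> oO [f [sf vf]] wv; exists (fun z => f (lsubmx z)); split.
  exact: smooth_on_lsubmx.
move=> phi tphi; rewrite wv// vf; last exact: test_partial_integral.
rewrite Rn_integral_split; congr Rn_integral; apply/funext => x.
have [sphi cphi _] := tphi; have [M _ fsM] := compact_fiber_supported cphi.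
rewrite -(@Rn_integralZ _ _ M).
- by congr Rn_integral; apply/funext => xi; rewrite row_mxKl.
- exact: (smooth_fiber_continuous (smooth_slabT sphi)).
- exact: (fsM phi).
Qed.

Lemma test_tensor Omega phi (psi : 'rV[R]_p -> R) M :
    test_function Omega phi -> smooth_on setT psi -> box_supported M psi ->
  test_function (slab Omega) (fun z => phi (lsubmx z) * psi (rsubmx z)).
Proof.
move=> [sphi cphi phiO] spsi bpsi.
(* The support of the tensor product lies in [L], the continuous image of a product of two compact
   sets, which is closed because it is compact in a Hausdorff space. *)
pose K : set 'rV[R]_p := [set xi | forall k, `[- M, M]%classic (xi ord0 k)].
have cK : compact K.
  apply: (@rV_compact R p (fun=> `[- M, M]%classic)) => k.
  exact: segment_compact.
pose L := (fun z : 'rV[R]_n * 'rV[R]_p => row_mx z.1 z.2) @` (closed_support phi `*` K).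
have cL : compact L.
  apply: continuous_compact; last exact: compact_setX.
  apply: continuous_subspaceT => -[x xi].
  by apply: continuous_row_mx; [exact: cvg_fst|exact: cvg_snd].
have sub : closed_support (fun z => phi (lsubmx z) * psi (rsubmx z)) `<=` L.
  apply: closed_support_sub.
    by apply: compact_closed => //; exact: norm_hausdorff.
  move=> z nz; have [sz|/closed_support_eq0->] := pselect (closed_support phi (lsubmx z));
    last by rewrite mul0r.
  have [Kz|/existsNP[k nk]] := pselect (K (rsubmx z)).
    by case: nz; exists (lsubmx z, rsubmx z) => //=; rewrite hsubmxK.
  rewrite (bpsi _ k) ?mulr0// ltNge; apply/negP => zk; apply: nk.
  by rewrite /= in_itv /= -ler_norml.
split.
- apply: smooth_onM; first exact: openT.
    exact: (smooth_on_lsubmx openT sphi).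
  exact: smooth_on_rsubmx.
- exact: compact_closed_support cL sub.
- by move=> z /sub[[x xi] [/= /phiO xO _] <-]; exact: slab_row_mx.
Qed.

Lemma smooth_distribution_descend Omega u : open Omega ->
  smooth_distribution (slab Omega) (lift_distr (p := p) u) ->
  smooth_distribution Omega u.
Proof.
move=> oO [F [sF uF]]; have [psi [spsi bpsi psi1]] := @unit_bump R p.
pose H (z : 'rV[R]_(n + p)) := F z * psi (rsubmx z).
have sH : smooth_on (slab Omega) H.
  apply: smooth_onM => //; first exact: open_slab.
  by apply: (@smooth_on_subset _ _ setT) => //; exact: smooth_on_rsubmx.
have fH : fiber_supported Omega 1 H.
  by move=> x _ xi k xik; rewrite /H row_mxKr (bpsi _ k)// mulr0.
exists (partial_integral H); split; first exact: smooth_partial_integral sH fH.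
move=> phi tphi; have tt := test_tensor tphi spsi bpsi.
have -> : u phi = lift_distr u (fun z => phi (lsubmx z) * psi (rsubmx z)).
  congr u; apply/funext => x; rewrite -[LHS]mulr1 -psi1.
  rewrite -(@Rn_integralZ _ _ 1)//; last exact: smoothT_continuous.
  by congr Rn_integral; apply/funext => xi; rewrite row_mxKl row_mxKr.
rewrite uF// Rn_integral_split; congr Rn_integral; apply/funext => x.
(* Nothing is known of [F] over points outside [Omega], so the fibre integral cannot be manipulated
   there; but [phi] vanishes at such points. *)
have [Ox|nOx] := pselect (Omega x); last first.
  have phi0 : phi x = 0.
    by apply: closed_support_eq0; case: tphi => _ _ sub /sub.
  by rewrite phi0 mulr0; apply: Rn_integral_eq0 => xi; rewrite row_mxKl phi0 mul0r mulr0.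
rewrite mulrC -(@Rn_integralZ _ _ 1).
- congr Rn_integral; apply/funext => xi; rewrite /H row_mxKl row_mxKr; ring.
- exact: smooth_fiber_continuous sH Ox.
- exact: fH.
Qed.

End tensor.

Theorem theorem1p10 (R : realType) (n m p : nat)
    (sigma : 'I_n -> nat) (degs : 'I_m -> nat) (X : 'I_m -> vfield R n)
    (tau : 'I_p -> nat)
    (mul : 'rV[R]_(n + p) -> 'rV[R]_(n + p) -> 'rV[R]_(n + p))
    (inv : 'rV[R]_(n + p) -> 'rV[R]_(n + p))
    (Xt : 'I_m -> vfield R (n + p))
    (nu : nat) (c : seq 'I_m -> R) :
  (0 < nu)%N ->
  generalized_rockland sigma degs X tau mul inv Xt nu c ->
  hypoelliptic (diff_op X degs nu c).
Proof.
move=> _ [_ _ _ lifting hypo] Omega u Omega' oO du oO' O'O sLu.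
have smooth_Xt j : smooth_map (Xt j) by have [] := lift_left_invariant lifting j.
have XtX j z i : Xt j z 0 (lshift p i) = X j (lsubmx z) 0 i.
  have [Rj [_ Rj0 _ ->]] := lift_remainder lifting j.
  rewrite mxE row_mxEl; have /rowP/(_ i) := Rj0 z.
  by rewrite [in X in X -> _]mxE => ->; rewrite mxE addr0.
(* The descent takes place over [Omega'], and hypoellipticity is applied to the cylinders over
   [Omega] and [Omega']. *)
apply: (@smooth_distribution_descend R n p) => //.
apply: (hypo (slab Omega)).
- exact: open_slab.
- exact: is_distribution_lift.
- exact: open_slab.
- by move=> z /O'O.
- apply: smooth_distribution_lift oO' sLu _ => phi [sphi cphi _].
  exact: diff_op_lift.
Qed.
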